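(* Let $F \in \mathbb{V}'$ and $G \in \mathbb{Q}'$. For every $\epsilon \in [0,\epsilon_0)$ there exists a unique solution $(u_{X,\epsilon}, p_{X,\epsilon}) \in \mathbb{V}\times\mathbb{Q}$ of $$a(u_{X,\epsilon}, v) + (\mathcal{D} v, p_{X,\epsilon})_Q = F(v) \quad \forall v\in\mathbb{V}, \qquad (\mathcal{D} u_{X,\epsilon}, q)_Q - \epsilon (p_{X,\epsilon}, q)_Q = G(q) \quad \forall q \in \mathbb{Q}.$$ Moreover, there exist unique $z_{X,\epsilon}\in\mathbb{Z}$ and $\tilde z_{X,\epsilon}\in\tilde{\mathbb{Z}}$ such that $u_{X,\epsilon} = z_{X,\epsilon}+\tilde z_{X,\epsilon}$, and $$\|z_{X,\epsilon}\|_V \le C_X^{[1]}\|F\|_{\mathbb{Z}'},$$ $$\|\tilde z_{X,\epsilon}\|_V \le \epsilon\, C_{X,\epsilon}^{[2]} \|F\|_{\hat{\mathbb{Z}}'} + C_{X,\epsilon}^{[3]}\|G\|_{\mathbb{Q}'},$$ $$\|p_{X,\epsilon}\|_Q \le C_{X,\epsilon}^{[3]}\|F\|_{\hat{\mathbb{Z}}'} + C_{X,\epsilon}^{[4]}\|G\|_{\mathbb{Q}'},$$ where $\epsilon_0$, $C_X^{[1]}$, $C_{X,\epsilon}^{[2]}$, $C_{X,\epsilon}^{[3]}$, $C_{X,\epsilon}^{[4]}$ are the constants given in the context, according to the structure of $a(\cdot,\cdot)$.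
   Context: Setting. $V,Q$ are real Hilbert spaces with inner products $(\cdot,\cdot)_V,(\cdot,\cdot)_Q$, norms $\|\cdot\|_V,\|\cdot\|_Q$ and duals denoted by a prime. $a:V\times V\to\mathbb{R}$ is a continuous (not necessarily symmetric) bilinear form and $\mathcal{D}:V\to Q$ is a surjective bounded linear operator. With $Z=\ker\mathcal{D}$, there is $\alpha>0$ with $\alpha\le\inf_{u\in Z}\sup_{v\in Z}\frac{a(u,v)}{\|u\|_V\|v\|_V}$ and $\alpha\le\inf_{v\in Z}\sup_{u\in Z}\frac{a(u,v)}{\|u\|_V\|v\|_V}$. Infima and suprema of quotients are over nonzero vectors. $\mathbb{V}\subset V$, $\mathbb{Q}\subset Q$ are finite-dimensional subspaces with $\mathcal{D}\mathbb{V}=\mathbb{Q}$. Let $\mathbb{Z}=\{v\in\mathbb{V}:(\mathcal{D}v,q)_Q=0\ \forall q\in\mathbb{Q}\}$ and assume $$\alpha_X:=\inf_{u\in\mathbb{Z}}\sup_{v\in\mathbb{Z}}\frac{a(u,v)}{\|u\|_V\|v\|_V}=\inf_{v\in\mathbb{Z}}\sup_{u\in\mathbb{Z}}\frac{a(u,v)}{\|u\|_V\|v\|_V}>0,\qquad \beta_X:=\inf_{q\in\mathbb{Q}}\sup_{v\in\mathbb{V}}\frac{(\mathcal{D}v,q)_Q}{\|v\|_V\|q\|_Q}>0.$$ Let $M_a:=\sup_{u,v\in V}\frac{a(u,v)}{\|u\|_V\|v\|_V}$, $M_{\mathcal{D}}:=\sup_{v\in V}\frac{\|\mathcal{D}v\|_Q}{\|v\|_V}$,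 and $\tilde{\mathbb{Z}}:=\{v\in\mathbb{V}:a(v,z)=0\ \forall z\in\mathbb{Z}\}$, $\hat{\mathbb{Z}}:=\{v\in\mathbb{V}:a(z,v)=0\ \forall z\in\mathbb{Z}\}$. For a subspace $U\subseteq\mathbb{V}$, $\|F\|_{U'}:=\sup_{u\in U}|F(u)|/\|u\|_V$; and $\|G\|_{\mathbb{Q}'}:=\sup_{q\in\mathbb{Q}}|G(q)|/\|q\|_Q$. Possible additional structure of $a$: (A1) $a$ is symmetric and there is $\tilde\alpha_X>0$ with $a(u,u)\ge0$ for all $u\in\mathbb{V}$ and $a(z,z)\ge\tilde\alpha_X\|z\|_V^2$ for all $z\in\mathbb{Z}$. (A2) there is $\tilde\alpha_X>0$ with $a(u,u)\ge\tilde\alpha_X\|u\|_V^2$ for all $u\in\mathbb{V}$. (A3) $a$ is symmetric and satisfies (A2). Constants, by case (in each case with the indicated $\Upsilon_X$): - No additional assumption: $\Upsilon_X=1+\frac{M_a}{\alpha_X}$, $\epsilon_0=\frac1{M_a}\left(\frac{\beta_X}{\Upsilon_X}\right)^2$, $C_X^{[1]}=\frac1{\alpha_X}$, $C_{X,\epsilon}^{[2]}=\frac{\Upsilon_X^2}{\beta_X^2}\frac{\epsilon_0}{\epsilon_0-\epsilon}$, $C_{X,\epsilon}^{[3]}=\frac{\Upsilon_X}{\beta_X}\frac{\epsilon_0}{\epsilon_0-\epsilon}$, $C_{X,\epsilon}^{[4]}=\frac{M_a\Upsilon_X}{\beta_X^2}\frac{\epsilon_0}{\epsilon_0-\epsilon}$.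 - (A1) (without (A2)): $\Upsilon_X=1+\sqrt{M_a/\tilde\alpha_X}$, $\epsilon_0=\infty$, $C_X^{[1]}=\frac1{\tilde\alpha_X}$, $C_{X,\epsilon}^{[2]}=\frac{\Upsilon_X^2}{\beta_X^2}$, $C_{X,\epsilon}^{[3]}=\frac{\Upsilon_X}{\beta_X}$, $C_{X,\epsilon}^{[4]}=\frac{M_a}{\epsilon M_a+\beta_X^2}$. - (A2) (without symmetry): $\Upsilon_X=\frac{M_a}{\tilde\alpha_X}$, $\epsilon_0=\infty$, $C_X^{[1]}=\frac1{\tilde\alpha_X}$, $C_{X,\epsilon}^{[2]}=\frac{\Upsilon_X^3}{\epsilon\tilde\alpha_X\Upsilon_X^2+\beta_X^2}$, $C_{X,\epsilon}^{[3]}=\frac{\Upsilon_XM_{\mathcal{D}}}{\sqrt{(\epsilon\tilde\alpha_X\Upsilon_X^2+\beta_X^2)(\epsilon\tilde\alpha_X+M_{\mathcal{D}}^2)}}$, $C_{X,\epsilon}^{[4]}=\frac{M_a\Upsilon_X}{\epsilon M_a\Upsilon_X+\beta_X^2}$. - (A3): $\Upsilon_X=\sqrt{M_a/\tilde\alpha_X}$, $\epsilon_0=\infty$, $C_X^{[1]}=\frac1{\tilde\alpha_X}$, $C_{X,\epsilon}^{[2]}=\frac{\Upsilon_X^2}{\epsilon M_a+\beta_X^2}$, $C_{X,\epsilon}^{[3]}=\frac{\Upsilon_XM_{\mathcal{D}}}{\sqrt{(\epsilon\tilde\alpha_X\Upsilon_X^2+\beta_X^2)(\epsilon\tilde\alpha_X+M_{\mathcal{D}}^2)}}$,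 $C_{X,\epsilon}^{[4]}=\frac{M_a}{\epsilon M_a+\beta_X^2}$. *)

(* Defs.v *)
From HB Require Import structures.
From mathcomp Require Import all_boot all_order all_algebra.
From mathcomp Require Import all_classical all_reals all_analysis.

Set Implicit Arguments.
Unset Strict Implicit.
Unset Printing Implicit Defensive.

Import Order.TTheory GRing.Theory Num.Theory.
Import numFieldNormedType.Exports.

Local Open Scope classical_set_scope.
Local Open Scope ring_scope.

(* A real Hilbert space is a [completeNormedModType R] together with a real
   inner product [ip : {dot V for idfun}] inducing its norm. *)
Definition induces_norm (R : realType) (V : normedModType R)
    (ip : {dot V for idfun}) : Prop :=
  forall v : V, `|v| = Num.sqrt (ip v v).

Definition fin_dim_subspace (R : realType) (V : normedModType R) (A : set V)
    : Prop :=
  exists (n : nat) (e : 'I_n -> V),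
    A = range (fun c : 'I_n -> R => \sum_(i < n) c i *: e i).

(* Inf-sup constants are extended reals, so that the infimum is +oo (not 0)
   when A = {0}. *)
Definition infsup (R : realType) (U W : normedModType R) (b : U -> W -> R)
    (A : set U) (B : set W) : \bar R :=
  ereal_inf [set ereal_sup [set (b u w / (`|u| * `|w|))%:E | w in B `\ 0]
            | u in A `\ 0].

(* The suprema below are suprema of bounded sets of real numbers; [sup set0] is
   0, which is the value of the constants on a zero space. *)
Definition form_norm (R : realType) (V : normedModType R) (a : V -> V -> R)
    : R :=
  sup [set a p.1 p.2 / (`|p.1| * `|p.2|)
      | p in [set p : V * V | p.1 != 0 /\ p.2 != 0]].

Definition op_norm (R : realType) (V W : normedModType R) (D : V -> W) : R :=
  sup [set `|D v| / `|v| | v in [set v : V | v != 0]].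

Definition dual_norm (R : realType) (V : normedModType R) (U : set V)
    (F : V -> R) : R :=
  sup [set `|F u| / `|u| | u in U `\ 0].

(* F belongs to the dual of the subspace U; only its values on U matter. *)
Definition in_dual (R : realType) (V : normedModType R) (U : set V)
    (F : V -> R) : Prop :=
  (forall (c : R) (u v : V), U u -> U v -> F (c *: u + v) = c * F u + F v) /\
  (exists M : R, forall u : V, U u -> `|F u| <= M * `|u|).

Section DiscreteSpaces.
Context {R : realType} {V Q : normedModType R}.
Variables (ipQ : Q -> Q -> R) (a : V -> V -> R) (D : V -> Q).
Variables (VV : set V) (QQ : set Q).

Definition discrete_kernel : set V :=
  [set v | VV v /\ forall q, QQ q -> ipQ (D v) q = 0].

Definition Ztilde : set V :=
  [set v | VV v /\ forall z, discrete_kernel z -> a v z = 0].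

Definition Zhat : set V :=
  [set v | VV v /\ forall z, discrete_kernel z -> a z v = 0].

Definition saddle_solution (eps : R) (F : V -> R) (G : Q -> R) (u : V) (p : Q)
    : Prop :=
  [/\ VV u, QQ p,
      forall v, VV v -> a u v + ipQ (D v) p = F v &
      forall q, QQ q -> ipQ (D u) q - eps * ipQ p q = G q].

Definition structure_A1 (alt : R) : Prop :=
  [/\ forall u v, a u v = a v u, 0 < alt,
      forall u, VV u -> 0 <= a u u &
      forall z, discrete_kernel z -> alt * `|z| ^+ 2 <= a z z].

Definition structure_A2 (alt : R) : Prop :=
  0 < alt /\ forall u, VV u -> alt * `|u| ^+ 2 <= a u u.

Definition structure_A3 (alt : R) : Prop :=
  (forall u v, a u v = a v u) /\ structure_A2 alt.

End DiscreteSpaces.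

Record stability_constants (R : realType) := StabilityConstants {
  eps_0 : \bar R;
  C1 : \bar R;
  C2 : R -> \bar R;
  C3 : R -> \bar R;
  C4 : R -> \bar R }.

Section Constants.
Context {R : realType}.
Variables (Ma MD alt : R) (alX beX : \bar R).
Local Open Scope ereal_scope.

(* eps0 / (eps0 - eps), which is 1 in the limit eps0 = +oo *)
Definition eps_ratio (eps0 : \bar R) (eps : R) : \bar R :=
  if eps0 is r%:E then (r / (r - eps))%:E else 1.

Definition constants_general : stability_constants R :=
  let Ups := 1 + Ma%:E / alX in
  let eps0 := Ma%:E^-1 * (beX / Ups) ^+ 2 in
  {| eps_0 := eps0;
     C1 := alX^-1;
     C2 := fun eps => Ups ^+ 2 / beX ^+ 2 * eps_ratio eps0 eps;
     C3 := fun eps => Ups / beX * eps_ratio eps0 eps;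
     C4 := fun eps => Ma%:E * Ups / beX ^+ 2 * eps_ratio eps0 eps |}.

Definition constants_A1 : stability_constants R :=
  let Ups := (1 + Num.sqrt (Ma / alt))%R in
  {| eps_0 := +oo;
     C1 := (alt^-1)%:E;
     C2 := fun=> (Ups ^+ 2)%:E / beX ^+ 2;
     C3 := fun=> Ups%:E / beX;
     C4 := fun eps => Ma%:E / ((eps * Ma)%:E + beX ^+ 2) |}.

Definition constants_A2 : stability_constants R :=
  let Ups := (Ma / alt)%R in
  {| eps_0 := +oo;
     C1 := (alt^-1)%:E;
     C2 := fun eps =>
       (Ups ^+ 3)%:E / ((eps * alt * Ups ^+ 2)%:E + beX ^+ 2);
     C3 := fun eps =>
       (Ups * MD)%:E / sqrte (((eps * alt * Ups ^+ 2)%:E + beX ^+ 2)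
                              * (eps * alt + MD ^+ 2)%:E);
     C4 := fun eps => (Ma * Ups)%:E / ((eps * Ma * Ups)%:E + beX ^+ 2) |}.

Definition constants_A3 : stability_constants R :=
  let Ups := Num.sqrt (Ma / alt) in
  {| eps_0 := +oo;
     C1 := (alt^-1)%:E;
     C2 := fun eps => (Ups ^+ 2)%:E / ((eps * Ma)%:E + beX ^+ 2);
     C3 := fun eps =>
       (Ups * MD)%:E / sqrte (((eps * alt * Ups ^+ 2)%:E + beX ^+ 2)
                              * (eps * alt + MD ^+ 2)%:E);
     C4 := fun eps => Ma%:E / ((eps * Ma)%:E + beX ^+ 2) |}.

End Constants.

Definition stable_with (R : realType) (V Q : normedModType R)
    (ipQ : Q -> Q -> R) (a : V -> V -> R) (D : V -> Q)
    (VV : set V) (QQ : set Q) (K : stability_constants R) : Prop :=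
  let ZZ := discrete_kernel ipQ D VV QQ in
  let Zt := Ztilde ipQ a D VV QQ in
  let Zh := Zhat ipQ a D VV QQ in
  forall (F : V -> R) (G : Q -> R) (eps : R),
  in_dual VV F -> in_dual QQ G -> 0 <= eps -> (eps%:E < eps_0 K)%E ->
  exists up : V * Q,
    unique (fun x => saddle_solution ipQ a D VV QQ eps F G x.1 x.2) up /\
    exists z : V * V,
      unique (fun y => [/\ ZZ y.1, Zt y.2 & up.1 = y.1 + y.2]) z /\
      [/\ (`|z.1|%:E <= C1 K * (dual_norm ZZ F)%:E)%E,
          (`|z.2|%:E <= eps%:E * C2 K eps * (dual_norm Zh F)%:E
                        + C3 K eps * (dual_norm QQ G)%:E)%E &
          (`|up.2|%:E <= C3 K eps * (dual_norm Zh F)%:E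
                         + C4 K eps * (dual_norm QQ G)%:E)%E].

(* Main.v *)
Require Import Defs.
From HB Require Import structures.
From mathcomp Require Import all_boot all_order all_algebra.
From mathcomp Require Import all_classical all_reals all_analysis.
From mathcomp Require Import ring lra.

(* Write u = z + y with z in the discrete kernel ZZ and y in Ztilde.  Testing
   with ZZ gives a(z, w) = F(w), hence the bound on z.  Testing with Zhat kills
   z and leaves a problem for (y, p) alone, which is split by linearity into a
   part driven by F and a part driven by G.  The projections of VV onto Ztilde
   and Zhat along ZZ have norm at most Ups, so D is bounded below on both spaces
   by beX / Ups.  In the general case the two resulting inequalities
     |y| <= (Ups / beX) |D y|   and   beX |p| <= Ups |F| + Ma |y|
   close by absorption for eps < eps_0; in the other cases the energy identity
   a(y, y) + eps |p|^2 = F(y^) (resp. -(g, p)) removes the restriction, where y^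
   is the component of y in Zhat.  The estimates also hold for the transposed
   form, so the transposed homogeneous problem has only the trivial solution,
   and existence follows from the Fredholm alternative in finite dimension. *)

Set Implicit Arguments.
Unset Strict Implicit.
Unset Printing Implicit Defensive.

Import Order.TTheory GRing.Theory Num.Theory.
Import numFieldNormedType.Exports.

Local Open Scope classical_set_scope.
Local Open Scope ring_scope.

Local Notation form R U W := {bilinear U -> W -> R | *%R & *%R}.

(** * Finite-dimensional subspaces *)

Definition linear_on (R : realType) (V : normedModType R) (A : set V)
    (F : V -> R) : Prop :=
  forall (c : R) (u v : V), A u -> A v -> F (c *: u + v) = c * F u + F v.

Lemma fin_dim_comb (R : realType) (V : normedModType R) (A : set V) :
  fin_dim_subspace A ->
  forall (c : R) (u v : V), A u -> A v -> A (c *: u + v).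
Proof.
case=> n [e ->] c _ _ [x _ <-] [y _ <-].
exists (fun i => c * x i + y i) => //.
rewrite scaler_sumr -big_split /=; apply: eq_bigr => i _.
by rewrite scalerDl scalerA.
Qed.

Lemma fin_dimB (R : realType) (E : normedModType R) (A : set E) (u v : E) :
  fin_dim_subspace A -> A u -> A v -> A (u - v).
Proof.
by move=> fA Au Av; rewrite addrC -scaleN1r; apply: fin_dim_comb.
Qed.

Lemma fin_dimD (R : realType) (E : normedModType R) (A : set E) (u v : E) :
  fin_dim_subspace A -> A u -> A v -> A (u + v).
Proof. by move=> fA Au Av; rewrite -[u]scale1r; apply: fin_dim_comb. Qed.

Lemma fin_dim0 (R : realType) (V : normedModType R) (A : set V) :
  fin_dim_subspace A -> A 0.
Proof.
case=> n [e ->]; exists (fun=> 0) => //.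
by apply: big1 => i _; rewrite scale0r.
Qed.

Lemma linear_on0 (R : realType) (V : normedModType R) (A : set V)
    (F : V -> R) :
  fin_dim_subspace A -> linear_on A F -> F 0 = 0.
Proof.
move=> /fin_dim0 A0 /(_ 1 0 0 A0 A0); rewrite scaler0 addr0 mul1r.
by move/(congr1 (fun x => x - F 0)); rewrite addrK subrr.
Qed.

Lemma linear_on_sum (R : realType) (V : normedModType R) (A : set V)
    (F : V -> R) (n : nat) (e : 'I_n -> V) (c : 'I_n -> R) :
  fin_dim_subspace A -> linear_on A F -> (forall i, A (e i)) ->
  F (\sum_i c i *: e i) = \sum_i c i * F (e i).
Proof.
move=> fA lF Ae.
(* Membership in [A] is carried along the induction, because [F] is linear only on [A]. *)
suff [] : A (\sum_i c i *: e i) /\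
  F (\sum_i c i *: e i) = \sum_i c i * F (e i) by [].
elim/big_rec2: _ => [|i s u _ [Au <-]].
  by split; [exact: fin_dim0 | exact: linear_on0 lF].
by split; [exact: fin_dim_comb | exact: lF].
Qed.

(** The saddle point problem lives on a product. The spanning families of the factors, padded with
    zeros, are concatenated along [fintype.split]. *)
Lemma fin_dim_prod (R : realType) (V Q : normedModType R)
    (A : set V) (B : set Q) :
  fin_dim_subspace A -> fin_dim_subspace B -> fin_dim_subspace (A `*` B).
Proof.
move=> [n [e eA]] [m [f fB]].
exists (n + m)%N, (fun i => match fintype.split i with
  | inl j => (e j, 0) | inr j => (0, f j) end).
have sl j : fintype.split (lshift m j : 'I_(n + m)) = inl j.
  exact: unsplitK (inl j).
have sr j : fintype.split (rshift n j : 'I_(n + m)) = inr j.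
  exact: unsplitK (inr j).
have E (c : 'I_(n + m) -> R) : \sum_i c i *: (match fintype.split i with
    | inl j => (e j, 0) | inr j => (0, f j) end) =
    (\sum_i c (lshift m i) *: e i, \sum_i c (rshift n i) *: f i) :> V * Q.
  rewrite big_split_ord /=.
  under eq_bigr => i _ do rewrite sl.
  under [X in _ + X]eq_bigr => i _ do rewrite sr.
  have pE (x y : V * Q) : x.1 = y.1 -> x.2 = y.2 -> x = y.
    by case: x y => [? ?] [? ?] /= -> ->.
  apply: pE; rewrite raddfD !raddf_sum /=.
    by rewrite [X in _ + X]big1 ?addr0 // => i _; rewrite scaler0.
  by rewrite big1 ?add0r // => i _; rewrite scaler0.
rewrite eA fB; apply/seteqP; split=> [[_ _] [/= [x _ <-] [y _ <-]]|_ [c _ <-]].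
  exists (fun i => match fintype.split i with
    | inl j => x j | inr j => y j end) => //.
  rewrite E; congr (_, _); apply: eq_bigr => i _.
    by rewrite sl.
  by rewrite sr.
by rewrite E; split; [exists (c \o lshift m) | exists (c \o @rshift n m)].
Qed.

Lemma form_suml (R : realType) (V Q : normedModType R) (b : form R V Q)
    (n : nat) (c : 'I_n -> R) (e : 'I_n -> V) (w : Q) :
  b (\sum_i c i *: e i) w = \sum_i c i * b (e i) w.
Proof. by rewrite linear_sumlz; apply: eq_bigr => i _; rewrite linearZl_LR. Qed.

Lemma form_sumr (R : realType) (V Q : normedModType R) (b : form R V Q)
    (n : nat) (c : 'I_n -> R) (e : 'I_n -> Q) (u : V) :
  b u (\sum_i c i *: e i) = \sum_i c i * b u (e i).
Proof. by rewrite linear_sumr; apply: eq_bigr => i _; rewrite linearZr_LR. Qed.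

Lemma span_basis (R : realType) (V : normedModType R) (n : nat)
    (e : 'I_n -> V) (i : 'I_n) :
  range (fun c : 'I_n -> R => \sum_i c i *: e i) (e i).
Proof.
exists (fun j => (j == i)%:R) => //.
rewrite (bigD1 i) //= eqxx scale1r big1 ?addr0 // => j /negPf ->.
by rewrite scale0r.
Qed.

(** With [M] the matrix of [b] on spanning families, solvability says that the row [r] of values of
    [F] lies in the row space of [M]. This is tested against the columns of [cokermx M], each of
    which gives a [w] annihilated by [b]. *)
Lemma fredholm (R : realType) (V Q : normedModType R) (b : form R V Q)
    (A : set V) (B : set Q) (F : Q -> R) :
  fin_dim_subspace A -> fin_dim_subspace B -> linear_on B F ->
  (forall w, B w -> (forall u, A u -> b u w = 0) -> F w = 0) ->
  exists2 u, A u & forall w, B w -> b u w = F w.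
Proof.
move=> fA fB lF kF; have [n [e eA]] := fA; have [m [f eB]] := fB.
pose M := \matrix_(i < n, j < m) b (e i) (f j).
pose r := \row_(j < m) F (f j).
have Ae i : A (e i) by rewrite eA; apply: span_basis.
have Bf j : B (f j) by rewrite eB; apply: span_basis.
have /submxP[c rE] : (r <= M)%MS.
  rewrite submxE; apply/eqP/rowP => k; rewrite !mxE.
  pose w := \sum_j cokermx M j k *: f j.
  have Fw : F w = \sum_j cokermx M j k * F (f j).
    by rewrite (linear_on_sum _ fB lF).
  transitivity (F w).
    by rewrite Fw; apply: eq_bigr => j _; rewrite mxE mulrC.
  apply: kF => [|u].
    by rewrite eB; exists (fun j => cokermx M j k).
  rewrite eA => -[x _ <-]; rewrite form_suml big1 // => i _.
  rewrite form_sumr.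
  have /matrixP/(_ i k) := mulmx_coker M; rewrite !mxE => Mw.
  rewrite [X in _ * X](_ : _ = 0) ?mulr0 // -[RHS]Mw.
  by apply: eq_bigr => j _; rewrite !mxE mulrC.
exists (\sum_i c 0 i *: e i) => [|w].
  by rewrite eA; exists (fun i => c 0 i).
rewrite eB => -[x _ <-].
rewrite (linear_on_sum _ fB lF) // form_sumr; apply: eq_bigr => j _.
congr (_ * _); have /rowP/(_ j) := rE; rewrite !mxE => ->.
by rewrite form_suml; apply: eq_bigr => i _; rewrite mxE.
Qed.

(** The rows of the left kernel of the matrix of [b] are the coefficient vectors of a spanning
    family. *)
Lemma fin_dim_kernel (R : realType) (V Q : normedModType R) (b : form R V Q)
    (A : set V) (B : set Q) :
  fin_dim_subspace A -> fin_dim_subspace B ->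
  fin_dim_subspace [set u | A u /\ forall w, B w -> b u w = 0].
Proof.
move=> [n [e ->]] [m [f ->]].
pose M := \matrix_(i < n, j < m) b (e i) (f j).
exists n, (fun k => \sum_i kermx M k i *: e i).
apply/seteqP; split=> [_ [[x _ <-] kx]|_ [c _ <-]].
  have /submxP[d dE] : (\row_i x i <= kermx M)%MS.
    apply/sub_kermxP/rowP => j; rewrite !mxE.
    rewrite -[RHS](kx (f j)); last exact: span_basis.
    by rewrite form_suml; apply: eq_bigr => i _; rewrite !mxE.
  exists (fun k => d 0 k) => //.
  under eq_bigr => k _ do rewrite scaler_sumr.
  rewrite exchange_big /=; apply: eq_bigr => i _.
  have /rowP/(_ i) := dE; rewrite !mxE => ->.
  by rewrite scaler_suml; apply: eq_bigr => k _; rewrite scalerA.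
have cE : \sum_k c k *: (\sum_i kermx M k i *: e i) =
    \sum_i (\sum_k c k * kermx M k i) *: e i.
  under eq_bigr => k _ do rewrite scaler_sumr.
  rewrite exchange_big /=; apply: eq_bigr => i _.
  by rewrite scaler_suml; apply: eq_bigr => k _; rewrite scalerA.
split; first by rewrite cE; exists (fun i => \sum_k c k * kermx M k i).
have kb k j : b (\sum_i kermx M k i *: e i) (f j) = 0.
  have /matrixP/(_ k j) := mulmx_ker M; rewrite !mxE => kM.
  rewrite form_suml -[RHS]kM.
  by apply: eq_bigr => i _; rewrite [M i j]mxE.
move=> _ [x _ <-]; rewrite form_sumr big1 // => j _.
by rewrite form_suml big1 ?mulr0 // => k _; rewrite kb mulr0.
Qed.

(** * Bilinear forms and the saddle point operator *)

(** The transpose gets its own bilinear instance, so that estimates for a generic form also cover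
    the adjoint problem; [Ztilde] of [flip a] is [Zhat] of [a]. *)
Definition flip (R : realType) (U W : normedModType R) (b : form R U W)
    (w : W) (u : U) : R := b u w.

Lemma flip_bilinear (R : realType) (U W : normedModType R) (b : form R U W) :
  bilinear_for *%R *%R (flip b).
Proof. by split=> x c u v /=; rewrite /flip ?linearPl ?linearPr. Qed.

HB.instance Definition _ (R : realType) (U W : normedModType R)
    (b : form R U W) :=
  bilinear_isBilinear.Build R W U R *%R *%R (flip b) (flip_bilinear b).

(** Repackages the Hermitian form as a bilinear form over [*%R] on both sides, the type shared by
    all lemmas on forms. *)
Definition dot_form (R : realType) (V : normedModType R)
    (ip : {dot V for idfun}) (u v : V) : R := ip u v.

Lemma dot_form_bilinear (R : realType) (V : normedModType R)
    (ip : {dot V for idfun}) : bilinear_for *%R *%R (dot_form ip).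
Proof. by split=> x c u v /=; rewrite /dot_form ?linearPl ?linearPr. Qed.

HB.instance Definition _ (R : realType) (V : normedModType R)
    (ip : {dot V for idfun}) :=
  bilinear_isBilinear.Build R V V R *%R *%R (dot_form ip)
    (dot_form_bilinear ip).

Lemma dot_formC (R : realType) (V : normedModType R) (ip : {dot V for idfun})
    (u v : V) : dot_form ip u v = dot_form ip v u.
Proof. by rewrite /dot_form hermC /= expr0 mul1r. Qed.

Lemma dot_form_norm (R : realType) (V : normedModType R)
    (ip : {dot V for idfun}) : induces_norm ip ->
  forall v, dot_form ip v v = `|v| ^+ 2.
Proof.
move=> ipN v; rewrite ipN sqr_sqrtr // /dot_form.
have [->|v0] := eqVneq v 0; first by rewrite linear0l.
exact/ltW/neq0_dnorm_gt0.
Qed.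

Definition div_form (R : realType) (V Q : normedModType R) (s : form R Q Q)
    (D : {linear V -> Q}) (v : V) (q : Q) : R := s (D v) q.

Lemma div_form_bilinear (R : realType) (V Q : normedModType R)
    (s : form R Q Q) (D : {linear V -> Q}) :
  bilinear_for *%R *%R (div_form s D).
Proof.
by split=> x c u v /=; rewrite /div_form ?linearP ?linearPl ?linearPr.
Qed.

HB.instance Definition _ (R : realType) (V Q : normedModType R)
    (s : form R Q Q) (D : {linear V -> Q}) :=
  bilinear_isBilinear.Build R V Q R *%R *%R (div_form s D)
    (div_form_bilinear s D).

(** The two equations added together; the test pairs [(v, 0)] and [(0, q)] separate them again. *)
Definition saddle_form (R : realType) (V Q : normedModType R)
    (s : form R Q Q) (a : form R V V) (D : {linear V -> Q}) (eps : R)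
    (x y : V * Q) : R :=
  a x.1 y.1 + div_form s D y.1 x.2 +
  (div_form s D x.1 y.2 - eps * s x.2 y.2).

Lemma saddle_form_bilinear (R : realType) (V Q : normedModType R)
    (s : form R Q Q) (a : form R V V) (D : {linear V -> Q}) (eps : R) :
  bilinear_for *%R *%R (saddle_form s a D eps).
Proof.
split=> z c x y /=; rewrite /saddle_form /= !(linearPl, linearPr) /GRing.scale /=;
  ring.
Qed.

HB.instance Definition _ (R : realType) (V Q : normedModType R)
    (s : form R Q Q) (a : form R V V) (D : {linear V -> Q}) (eps : R) :=
  bilinear_isBilinear.Build R (V * Q)%type (V * Q)%type R *%R *%R
    (saddle_form s a D eps) (saddle_form_bilinear s a D eps).

(** By [fredholm] on the product space: a pair annihilated by the transposed [saddle_form] solves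
    the homogeneous problem for [flip a], since the coupling and the [eps] block are symmetric. *)
Lemma saddle_exists (R : realType) (V Q : normedModType R)
    (s : form R Q Q) (a : form R V V) (D : {linear V -> Q}) (eps : R)
    (VV : set V) (QQ : set Q) (F : V -> R) (G : Q -> R) :
  fin_dim_subspace VV -> fin_dim_subspace QQ ->
  linear_on VV F -> linear_on QQ G ->
  (forall p q, s p q = s q p) ->
  (forall u p, saddle_solution s (flip a) D VV QQ eps (fun=> 0) (fun=> 0) u p ->
    u = 0 /\ p = 0) ->
  exists u p, saddle_solution s a D VV QQ eps F G u p.
Proof.
move=> fV fQ lF lG sC uniq0.
have [V0 Q0] := (fin_dim0 fV, fin_dim0 fQ).
have [F0 G0] := (linear_on0 fV lF, linear_on0 fQ lG).
have fVQ := fin_dim_prod fV fQ.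
have lFG : linear_on (VV `*` QQ) (fun x => F x.1 + G x.2).
  by move=> c [u p] [v q] /= [Vu Qp] [Vv Qq] /=; rewrite lF // lG //; ring.
have [[v q] /= [Vv Qq] K|[u p] /= [Vu Qp] E] :=
    @fredholm _ _ _ (saddle_form s a D eps) _ _ _ fVQ fVQ lFG.
  have [] := uniq0 v q; last by move=> -> ->; rewrite F0 G0 addr0.
  split=> // [u Vu|p Qp].
    have := K (u, 0) (conj Vu Q0); rewrite /saddle_form /div_form /flip /=.
    by rewrite !linear0r linear0l mulr0 subr0 addr0.
  have := K (0, p) (conj V0 Qp); rewrite /saddle_form /div_form /flip /=.
  by rewrite linear0 !linear0l !add0r (sC p).
exists u, p; split=> // [v Vv|q Qq].
  have := E (v, 0) (conj Vv Q0); rewrite /saddle_form /div_form /=.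
  by rewrite G0 !linear0r ?mulr0 subr0 !addr0.
have := E (0, q) (conj V0 Qq); rewrite /saddle_form /div_form /=.
by rewrite F0 !linear0 linear0l !add0r.
Qed.

(** The form is only semidefinite on [A], so the case [b v v = 0] needs its own argument. *)
Lemma cauchy_schwarz (R : realType) (V : normedModType R) (b : form R V V)
    (A : set V) :
  (forall u v, b u v = b v u) ->
  (forall (c : R) u v, A u -> A v -> A (c *: u + v)) ->
  (forall u, A u -> 0 <= b u u) ->
  forall u v, A u -> A v -> b u v ^+ 2 <= b u u * b v v.
Proof.
move=> bC lA b0 u v Au Av.
have q t : 0 <= t ^+ 2 * b v v + 2 * t * b u v + b u u.
  have := b0 _ (lA t v u Av Au).
  rewrite linearPl !(linearPr b) (bC v u) => h.
  by apply: le_trans h _; rewrite le_eqVlt; apply/orP; left; apply/eqP; ring.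
have [v0|v0] := eqVneq (b v v) 0.
  have [->|uv0] := eqVneq (b u v) 0; first by rewrite expr0n v0 mulr0.
  (* The quadratic in [q] is affine here, and this [t] gives it the value [-1]. *)
  have := q (- (b u u + 1) / (2 * b u v)); rewrite v0 mulr0 add0r.
  rewrite (_ : 2 * _ * _ = - (b u u + 1)); last by field.
  lra.
have vp : 0 < b v v by rewrite lt_def v0 b0.
rewrite -subr_ge0 -(pmulr_lge0 _ (_ : 0 < (b v v)^-1)) ?invr_gt0 //.
(* The minimiser of the quadratic. *)
by apply: le_trans (q (- b u v / b v v)) _; rewrite le_eqVlt; apply/orP; left;
  apply/eqP; field.
Qed.

Lemma dot_le (R : realType) (V : normedModType R) (s : form R V V) :
  (forall u v, s u v = s v u) -> (forall v, s v v = `|v| ^+ 2) ->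
  forall u v, `|s u v| <= `|u| * `|v|.
Proof.
move=> sC sN u v; rewrite -ler_sqr ?nnegrE ?mulr_ge0 // exprMn -!sN.
rewrite real_normK ?num_real //.
by apply: (@cauchy_schwarz _ _ s setT) => // w _; rewrite sN sqr_ge0.
Qed.

(** * Inf-sup constants and norms *)

(** The working form of an inf-sup condition: [K / |u|] bounds every quotient at [u], hence the
    inner supremum, which dominates [be]. *)
Lemma infsup_le (R : realType) (U W : normedModType R) (b : U -> W -> R)
    (A : set U) (B : set W) (be K : R) (u : U) :
  (be%:E <= infsup b A B)%E -> A u -> 0 <= K ->
  (forall w, B w -> b u w <= K * `|w|) -> be * `|u| <= K.
Proof.
move=> beb Au K0 uK; have [->|u0] := eqVneq u 0; first by rewrite normr0 mulr0.
have un : 0 < `|u| by rewrite normr_gt0.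
rewrite -ler_pdivlMr // -lee_fin; apply: le_trans beb _.
apply: (@le_trans _ _ (ereal_sup
  [set (b u w / (`|u| * `|w|))%:E | w in B `\ 0])).
  by apply: ereal_inf_lbound; exists u => //; split => // /eqP; apply/negP.
apply: ge_ereal_sup => _ [w [Bw w0] <-]; rewrite lee_fin.
have wn : 0 < `|w| by rewrite normr_gt0; apply/eqP.
rewrite ler_pdivrMr ?mulr_gt0 //.
by rewrite mulrA divfK ?gt_eqF // uK.
Qed.

(** An empty or unbounded set has [sup] equal to 0, so these cases agree with the claim. *)
Lemma sup_nonneg (R : realType) (S : set R) :
  (forall x, S x -> 0 <= x) -> 0 <= sup S.
Proof.
move=> S0; have [[[x Sx] Su]|/sup_out ->//] := pselect (has_sup S).
exact: le_trans (S0 x Sx) (ub_le_sup Su Sx).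
Qed.

Lemma op_norm_ge0 (R : realType) (V W : normedModType R) (D : V -> W) :
  0 <= op_norm D.
Proof. by apply: sup_nonneg => _ [v _ <-]; rewrite divr_ge0. Qed.

Lemma op_normP (R : realType) (V W : normedModType R) (D : {linear V -> W}) :
  bounded_near D (nbhs (0 : V)) ->
  forall v, `|D v| <= op_norm D * `|v|.
Proof.
move=> /linear_boundedP[M [Mr Mb]] v.
have [->|v0] := eqVneq v 0; first by rewrite linear0 !normr0 mulr0.
rewrite -ler_pdivrMr ?normr_gt0 //; apply: ub_le_sup; last by exists v.
(* [linear_boundedP] gives the bound only for constants strictly above [M]. *)
exists (M + 1) => _ [w /= w0 <-]; rewrite ler_pdivrMr ?normr_gt0 //.
by apply: Mb; rewrite ltrDl.
Qed.

Lemma dual_norm_ge0 (R : realType) (V : normedModType R) (U : set V)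
    (F : V -> R) : 0 <= dual_norm U F.
Proof. by apply: sup_nonneg => _ [v _ <-]; rewrite divr_ge0. Qed.

Lemma dual_normP (R : realType) (V : normedModType R) (A U : set V)
    (F : V -> R) : fin_dim_subspace A -> U `<=` A -> in_dual A F ->
  forall v, U v -> `|F v| <= dual_norm U F * `|v|.
Proof.
move=> fA UA [lF [M Mb]] v Uv.
have [->|v0] := eqVneq v 0.
  by rewrite (linear_on0 fA lF) !normr0 mulr0.
rewrite -ler_pdivrMr ?normr_gt0 //; apply: ub_le_sup.
  exists M => _ [w /= [Uw /eqP w0] <-]; rewrite ler_pdivrMr ?normr_gt0 //.
  exact/Mb/UA.
by exists v => //; split=> //; apply/eqP.
Qed.

(** Continuity at the origin gives a radius [r] within which [a] stays below 1 in absolute value;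
    rescaling both arguments to norm [r / 2] gives the constant. *)
Lemma form_bounded (R : realType) (V : normedModType R) (a : form R V V) :
  continuous (fun p : V * V => a p.1 p.2) ->
  exists2 M : R, 0 <= M & forall u v, a u v <= M * (`|u| * `|v|).
Proof.
move=> ac; have := ac (0, 0) => /cvgr_dist_lt /(_ 1 ltr01).
rewrite /= linear0l => /nbhs_ballP[r /= r0 rb].
exists ((2 / r) ^+ 2); first exact: sqr_ge0.
move=> u v; have [->|u0] := eqVneq u 0.
  by rewrite linear0l normr0 mul0r mulr0.
have [->|v0] := eqVneq v 0; first by rewrite linear0r normr0 !mulr0.
have [un vn] : 0 < `|u| /\ 0 < `|v| by rewrite !normr_gt0.
have hb (w : V) : w != 0 -> ball 0 r ((r / 2 / `|w|) *: w).
  move=> w0; rewrite -ball_normE /= sub0r normrN normrZ ger0_norm.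
    by rewrite divfK ?normr_eq0 // ltr_pdivrMr // ltr_pMr // ltr1n.
  by rewrite !divr_ge0 // ltW.
have := rb ((r / 2 / `|u|) *: u, (r / 2 / `|v|) *: v) (conj (hb _ u0) (hb _ v0)).
rewrite /= sub0r normrN linearZl_LR linearZr_LR /=.
move=> /ltW /(le_trans (ler_norm _)).
rewrite (_ : r / 2 / `|u| * _ =
    ((2 / r) ^+ 2)^-1 * (`|u| * `|v|)^-1 * a u v); last first.
  by field; rewrite !gt_eqF.
rewrite -invfM ler_pdivrMl ?mulr1 ?mulrA //.
by rewrite !mulr_gt0 // ?divr_gt0 // invr_gt0.
Qed.

(** The quotients carry no absolute value; where [a u v] is negative, the pair [(- u, v)] supplies a
    nonnegative one. *)
Lemma form_norm_ge0 (R : realType) (V : normedModType R) (a : form R V V) :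
  continuous (fun p : V * V => a p.1 p.2) -> 0 <= form_norm a.
Proof.
move=> /form_bounded[M M0 Mb]; rewrite /form_norm.
set S := (X in sup X).
have [[_ [[u v] /= [u0 v0] _]]|/nonemptyPn S0] := pselect (S !=set0); last first.
  by rewrite S0 sup0.
have uv : 0 < `|u| * `|v| by rewrite mulr_gt0 // normr_gt0.
have hub : has_ubound S.
  exists M => _ [[w x] /= [w0 x0] <-].
  by rewrite ler_pdivrMr ?mulr_gt0 ?normr_gt0.
have [auv|auv] := leP 0 (a u v).
  apply: (@le_trans _ _ (a u v / (`|u| * `|v|))).
    by rewrite divr_ge0 // ltW.
  by apply: ub_le_sup => //; exists (u, v).
apply: (@le_trans _ _ (a (- u) v / (`|- u| * `|v|))).
  by rewrite normrN linearNl divr_ge0 ?(ltW uv) // oppr_ge0 ltW.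
by apply: ub_le_sup => //; exists (- u, v) => //=; rewrite oppr_eq0.
Qed.

Lemma form_normP (R : realType) (V : normedModType R) (a : form R V V) :
  continuous (fun p : V * V => a p.1 p.2) ->
  forall u v, `|a u v| <= form_norm a * `|u| * `|v|.
Proof.
move=> /form_bounded[M M0 Mb].
have h u v : a u v <= form_norm a * `|u| * `|v|.
  have [->|u0] := eqVneq u 0; first by rewrite linear0l normr0 mulr0 mul0r.
  have [->|v0] := eqVneq v 0; first by rewrite linear0r normr0 mulr0.
  rewrite -mulrA -ler_pdivrMr ?mulr_gt0 ?normr_gt0 //; apply: ub_le_sup.
    exists M => _ [[w x] /= [w0 x0] <-].
    by rewrite ler_pdivrMr ?mulr_gt0 ?normr_gt0.
  by exists (u, v).
(* The lower bound is the upper bound at [- u]. *)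
move=> u v; rewrite ler_norml h andbT lerNl -linearNl -(normrN u).
exact: h.
Qed.

(* The lifting solves the saddle point problem in which the inner product of V
   replaces a; its multiplier r satisfies be * |r| <= |v|. *)
Lemma bounded_lift (R : realType) (V Q : normedModType R)
    (m : form R V V) (s : form R Q Q) (D : {linear V -> Q})
    (VV : set V) (QQ : set Q) (be : R) :
  (forall u v, m u v = m v u) -> (forall v, m v v = `|v| ^+ 2) ->
  (forall p q, s p q = s q p) -> (forall q, s q q = `|q| ^+ 2) ->
  fin_dim_subspace VV -> fin_dim_subspace QQ -> D @` VV = QQ -> 0 < be ->
  (be%:E <= infsup (fun q v => s (D v) q) QQ VV)%E ->
  forall q, QQ q -> exists v, [/\ VV v, D v = q & be * `|v| <= `|q|].
Proof.
move=> mC mN sC sN fV fQ DV be0 beb q Qq.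
have QD v : VV v -> QQ (D v) by move=> Vv; rewrite -DV; exists v.
have be_le (p : Q) (K : R) : QQ p -> 0 <= K ->
    (forall v, VV v -> s (D v) p <= K * `|v|) -> be * `|p| <= K.
  by move=> Qp K0; apply: infsup_le beb Qp K0.
have l0 : linear_on VV (fun=> 0) by move=> *; rewrite mulr0 addr0.
have lq : linear_on QQ (s q) by move=> c p r _ _; rewrite linearPr.
(* With [eps = 0] and data [(0, q)], [v] is the preimage of [q] of least norm. The first branch is
   uniqueness for the homogeneous problem. *)
have [u p [Vu Qp E1 E2]|v [r [Vv Qr E1 E2]]] :=
  @saddle_exists _ _ _ s m D 0 VV QQ (fun=> 0) (s q) fV fQ l0 lq sC.
  have u0 : u = 0.
    apply/eqP; rewrite -normr_eq0 -sqrf_eq0 -mN; apply/eqP.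
    have := E1 u Vu; have := E2 p Qp; rewrite mul0r subr0 => ->.
    by rewrite addr0.
  split=> //; apply/eqP; rewrite -normr_le0 -(pmulr_rle0 _ be0).
  apply: be_le => // v Vv; have := E1 v Vv.
  by rewrite /flip u0 linear0r add0r => ->; rewrite mul0r.
have Dv : D v = q.
  have Qd : QQ (D v - q).
    by rewrite addrC -scaleN1r; apply: fin_dim_comb => //; apply: QD.
  apply/eqP; rewrite -subr_eq0 -normr_eq0 -sqrf_eq0 -sN.
  rewrite linearBl /=; have := E2 _ Qd; rewrite mul0r subr0 => ->.
  by rewrite subrr.
exists v; split=> //.
have rv : be * `|r| <= `|v|.
  apply: be_le => // w Vw; have /eqP := E1 w Vw.
  rewrite addrC addr_eq0 => /eqP ->.
  rewrite -linearNl; apply: le_trans (ler_norm _) _.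
  by rewrite (le_trans (dot_le mC mN _ _)) // normrN.
have vq : `|v| ^+ 2 <= `|q| * `|r|.
  have := E1 v Vv; rewrite Dv mN => /eqP; rewrite addr_eq0 => /eqP ->.
  rewrite -linearNl; apply: le_trans (ler_norm _) _.
  by rewrite (le_trans (dot_le sC sN _ _)) // normrN.
have [->|v0] := eqVneq v 0; first by rewrite normr0 mulr0.
have vp : 0 < `|v| by rewrite normr_gt0.
(* [be |v|^2 <= |q| (be |r|) <= |q| |v|], and one factor [|v|] cancels. *)
rewrite -(ler_pM2r vp); apply: (@le_trans _ _ (`|q| * (be * `|r|))).
  by rewrite mulrCA -mulrA ler_pM2l // -expr2.
exact: ler_wpM2l.
Qed.

(** * Scalar inequalities that close the estimates *)

Lemma le_of_contraction (R : realFieldType) (x c th rho : R) :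
  0 <= rho -> (1 - th) * rho = 1 -> x <= c + th * x -> x <= c * rho.
Proof.
move=> rho0 rhoE xc; rewrite -[x]mulr1 -rhoE mulrA ler_wpM2r //.
lra.
Qed.

(* With t = x / d in [1 / MD, Ups / be] this bounds t / (1 + sg t^2):
   t / sqrt (1 + sg t^2) is increasing in t and 1 / sqrt (1 + sg t^2) is
   decreasing. *)
Lemma quotient_bound (R : rcfType) (x d sg Ups be MD : R) :
  0 <= x -> 0 <= d -> 0 <= sg -> 0 <= be -> 0 <= Ups -> 0 <= MD ->
  be * x <= Ups * d -> d <= MD * x ->
  x * d * Num.sqrt ((sg * Ups ^+ 2 + be ^+ 2) * (sg + MD ^+ 2)) <=
    Ups * MD * (sg * x ^+ 2 + d ^+ 2).
Proof.
move=> x0 d0 sg0 be0 U0 M0 bx dM.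
have A0 : 0 <= sg * Ups ^+ 2 + be ^+ 2 by rewrite addr_ge0 ?mulr_ge0 ?sqr_ge0.
have B0 : 0 <= sg + MD ^+ 2 by rewrite addr_ge0 ?sqr_ge0.
have E0 : 0 <= sg * x ^+ 2 + d ^+ 2 by rewrite addr_ge0 ?mulr_ge0 ?sqr_ge0.
rewrite -ler_sqr ?nnegrE ?mulr_ge0 ?sqrtr_ge0 //.
rewrite [leLHS]exprMn sqr_sqrtr ?mulr_ge0 //.
have h1 : x ^+ 2 * (sg * Ups ^+ 2 + be ^+ 2) <=
    Ups ^+ 2 * (sg * x ^+ 2 + d ^+ 2).
  have : (be * x) ^+ 2 <= (Ups * d) ^+ 2 by rewrite ler_sqr ?nnegrE ?mulr_ge0.
  by rewrite !exprMn; lra.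
have h2 : d ^+ 2 * (sg + MD ^+ 2) <= MD ^+ 2 * (sg * x ^+ 2 + d ^+ 2).
  have : d ^+ 2 <= (MD * x) ^+ 2 by rewrite ler_sqr ?nnegrE ?mulr_ge0.
  rewrite exprMn => /(ler_wpM2l sg0); lra.
rewrite [leLHS](_ : _ = (x ^+ 2 * (sg * Ups ^+ 2 + be ^+ 2)) *
  (d ^+ 2 * (sg + MD ^+ 2))); last by ring.
rewrite [leRHS](_ : _ = (Ups ^+ 2 * (sg * x ^+ 2 + d ^+ 2)) *
  (MD ^+ 2 * (sg * x ^+ 2 + d ^+ 2))); last by ring.
by apply: ler_pM h1 h2; rewrite mulr_ge0 ?sqr_ge0.
Qed.

(** Multiplied by [M], the energy inequality has [(be * P) ^+ 2] available in place of [M * E]; it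
    is then quadratic in [P] on the left and linear on the right, and one factor [P] cancels. *)
Lemma le_energy (R : realFieldType) (M be eps NG E P : R) :
  0 < be -> 0 <= M -> 0 <= eps -> 0 <= NG -> 0 <= P ->
  (be * P) ^+ 2 <= M * E -> eps * P ^+ 2 + E <= NG * P ->
  P <= M / (eps * M + be ^+ 2) * NG.
Proof.
move=> be0 M0 e0 N0 P0 h1 /(ler_wpM2l M0) h2.
have d0 : 0 < eps * M + be ^+ 2 by rewrite ltr_wpDl ?mulr_ge0 ?exprn_gt0.
rewrite mulrAC ler_pdivlMr //.
have [->|Pn] := eqVneq P 0; first by rewrite mul0r mulr_ge0.
have Pp : 0 < P by rewrite lt_def Pn.
rewrite -(ler_pM2r Pp); move: h1; rewrite exprMn; lra.
Qed.

Lemma le_sqrt_ratio (R : rcfType) (Ma alt x y E : R) :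
  0 <= Ma -> 0 < alt -> 0 <= x -> 0 <= y ->
  alt * x ^+ 2 <= E -> E <= Ma * y ^+ 2 -> x <= Num.sqrt (Ma / alt) * y.
Proof.
move=> Ma0 alt0 x0 y0 h1 h2.
have q0 : 0 <= Ma / alt by rewrite divr_ge0 // ltW.
rewrite -ler_sqr ?nnegrE ?mulr_ge0 ?sqrtr_ge0 // exprMn sqr_sqrtr //.
by rewrite mulrAC ler_pdivlMr // mulrC (le_trans h1).
Qed.

Lemma eps_ratio_ge0 (R : realType) (eps : R) (e : \bar R) :
  0 <= eps -> (eps%:E < e)%E -> (0 <= eps_ratio e eps)%E.
Proof.
case: e => [r||] //= e0; rewrite lte_fin lee_fin => er.
by rewrite divr_ge0 ?subr_ge0 ?(le_trans e0) ?ltW.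
Qed.

(** * The problem reduced to Ztilde *)

Section ReducedProblem.
Context {R : realType} {V Q : normedModType R}.
Variables (m : form R V V) (s : form R Q Q) (D : {linear V -> Q}).
Variables (VV : set V) (QQ : set Q).
Hypothesis mC : forall u v, m u v = m v u.
Hypothesis mN : forall v, m v v = `|v| ^+ 2.
Hypothesis sC : forall p q, s p q = s q p.
Hypothesis sN : forall q, s q q = `|q| ^+ 2.
Hypothesis fV : fin_dim_subspace VV.
Hypothesis fQ : fin_dim_subspace QQ.
Hypothesis DV : D @` VV = QQ.

Local Notation ZZ := (discrete_kernel s D VV QQ).
Local Notation Zt a := (Ztilde s a D VV QQ).
Local Notation Zh a := (Zhat s a D VV QQ).

Lemma image_in v : VV v -> QQ (D v).
Proof. by move=> Vv; rewrite -DV; exists v. Qed.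

(** Since [D] maps [VV] into [QQ], [q := D v] is an admissible test. *)
Lemma discrete_kernelE v : ZZ v <-> VV v /\ D v = 0.
Proof.
split=> [[Vv kv]|[Vv Dv]]; last by split=> // q Qq; rewrite Dv linear0l.
split=> //; have := kv _ (image_in Vv).
by rewrite sN => /eqP; rewrite sqrf_eq0 normr_eq0 => /eqP.
Qed.

Lemma fin_dim_discrete_kernel : fin_dim_subspace ZZ.
Proof. exact: (fin_dim_kernel (div_form s D)). Qed.

Lemma fin_dim_Ztilde (a : form R V V) : fin_dim_subspace (Zt a).
Proof. exact: fin_dim_kernel fV fin_dim_discrete_kernel. Qed.

(** Injectivity of [a] on [ZZ]; stated for [flip a] it gives, in finite dimension, solvability on
    [ZZ] of problems with [a]. *)
Definition nondegenerate (a : form R V V) : Prop :=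
  forall z, ZZ z -> (forall w, ZZ w -> a z w = 0) -> z = 0.

(** [u - z] is the projection of [u] onto [Ztilde] along [ZZ]; the relational form avoids choosing
    the projection as a function. *)
Definition projection_bound (a : form R V V) (Ups : R) : Prop :=
  forall u z, VV u -> ZZ z -> Zt a (u - z) -> `|u - z| <= Ups * `|u|.

(** [z] solves [a z w = a u w] on [ZZ]; nondegeneracy of the transpose is the compatibility
    condition of [fredholm]. *)
Lemma Ztilde_decomposition (a : form R V V) : nondegenerate (flip a) ->
  forall u, VV u -> exists2 z, ZZ z & Zt a (u - z).
Proof.
move=> nd u Vu; have fZ := fin_dim_discrete_kernel.
have la : linear_on ZZ (a u) by move=> c v w _ _; rewrite linearPr.
have [w Zw kw|z Zz E] := fredholm fZ fZ la (b := a).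
  by rewrite (nd w) ?linear0r.
exists z => //; split=> [|w Zw]; last by rewrite linearBl /= E // subrr.
by apply: fin_dimB => //; case: Zz.
Qed.

Lemma Ztilde_kernel0 (a : form R V V) : nondegenerate a ->
  forall v, ZZ v -> Zt a v -> v = 0.
Proof. by move=> nd v Zv [_ tv]; apply: nd. Qed.

(** The data enter only through the bounds [NF] and [NG]. The first is one-sided because [v] may be
    replaced by [- v]. *)
Definition reduced_solution (a : form R V V) (eps NF NG : R) (y : V) (p : Q)
    : Prop :=
  [/\ Zt a y, QQ p,
      forall v, Zh a v -> a y v + s (D v) p <= NF * `|v| &
      `|D y - eps *: p| <= NG].

(* G is represented by g := D y - eps *: p, and |g|^2 = G(g). *)
Lemma reduced_of_solution (a : form R V V) (eps NF NG : R) (F : V -> R)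
    (G : Q -> R) (u z y : V) (p : Q) :
  saddle_solution s a D VV QQ eps F G u p -> ZZ z -> Zt a y -> u = z + y ->
  (forall v, Zh a v -> F v <= NF * `|v|) ->
  (forall q, QQ q -> G q <= NG * `|q|) -> 0 <= NG ->
  (forall w, ZZ w -> a z w = F w) /\ reduced_solution a eps NF NG y p.
Proof.
move=> [Vu Qp E1 E2] Zz Ty uE FN GN NG0.
have [Vz Dz] := (discrete_kernelE z).1 Zz.
split=> [w Zw|].
  have [Vw Dw] := (discrete_kernelE w).1 Zw.
  by rewrite -E1 // Dw linear0l addr0 uE linearDl /= Ty.2 // addr0.
split=> // [v [Vv hv]|].
  apply: le_trans (FN v _); last by split.
  by rewrite -E1 // uE linearDl /= (hv _ Zz) add0r.
have Dy : D y = D u by rewrite uE linearD /= Dz add0r.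
have Qg : QQ (D y - eps *: p).
  by rewrite addrC -scaleNr; apply: fin_dim_comb => //; apply: image_in; case: Ty.
have := GN _ Qg; rewrite -E2 // -linearZl_LR -linearBl /= -Dy sN expr2.
set g := D y - eps *: p => h.
have [->|g0] := eqVneq g 0; first by rewrite normr0.
by rewrite -(ler_pM2r (_ : 0 < `|g|)) // normr_gt0.
Qed.

(** * Superposition, and the passage from estimates to stability *)

Lemma saddle_solutionD (a : form R V V) (eps : R) (F F' : V -> R)
    (G G' : Q -> R) (u u' : V) (p p' : Q) :
  saddle_solution s a D VV QQ eps F G u p ->
  saddle_solution s a D VV QQ eps F' G' u' p' ->
  saddle_solution s a D VV QQ eps (fun v => F v + F' v) (fun q => G q + G' q)
    (u + u') (p + p').
Proof.
move=> [Vu Qp E1 E2] [Vu' Qp' E1' E2'].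
split; [exact: fin_dimD | exact: fin_dimD | move=> v Vv | move=> q Qq].
  by rewrite -E1 // -E1' // linearDl (linearDr s) /=; ring.
by rewrite -E2 // -E2' // linearD !(linearDl s) /=; ring.
Qed.

Lemma saddle_solutionB (a : form R V V) (eps : R) (F : V -> R)
    (G : Q -> R) (u u' : V) (p p' : Q) :
  saddle_solution s a D VV QQ eps F G u p ->
  saddle_solution s a D VV QQ eps F G u' p' ->
  saddle_solution s a D VV QQ eps (fun=> 0) (fun=> 0) (u - u') (p - p').
Proof.
move=> [Vu Qp E1 E2] [Vu' Qp' E1' E2'].
split; [exact: fin_dimB | exact: fin_dimB | move=> v Vv | move=> q Qq].
  by rewrite -(subrr (F v)) -{1}E1 // -E1' // linearBl (linearBr s) /=; ring.
by rewrite -(subrr (G q)) -{1}E2 // -E2' // linearB !(linearBl s) /=; ring.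
Qed.

Definition reduced_estimates (K : stability_constants R) (a : form R V V)
    (eps : R) : Prop :=
  (forall NF y p, 0 <= NF -> reduced_solution a eps NF 0 y p ->
    (`|y|%:E <= eps%:E * C2 K eps * NF%:E)%E /\
    (`|p|%:E <= C3 K eps * NF%:E)%E) /\
  (forall NG y p, 0 <= NG -> reduced_solution a eps 0 NG y p ->
    (`|y|%:E <= C3 K eps * NG%:E)%E /\ (`|p|%:E <= C4 K eps * NG%:E)%E).

(** The load estimate at [NF = 0] removes [y] and [p]; nondegeneracy removes the part in [ZZ]. *)
Lemma homogeneous_trivial (K : stability_constants R) (a : form R V V)
    (eps : R) (u : V) (p : Q) :
  nondegenerate a -> nondegenerate (flip a) -> reduced_estimates K a eps ->
  saddle_solution s a D VV QQ eps (fun=> 0) (fun=> 0) u p -> u = 0 /\ p = 0.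
Proof.
move=> nd nd' [eF _] S; have [Vu _ _ _] := S.
have [z Zz Ty] := Ztilde_decomposition nd' Vu.
have uE : u = z + (u - z) by rewrite addrC subrK.
have [v _|q _||Ez red] := reduced_of_solution (NF := 0) (NG := 0) S Zz Ty uE.
- by rewrite mul0r.
- by rewrite mul0r.
- by [].
have z0 : z = 0 by apply: nd => // w Zw; rewrite Ez.
have [] := eF 0 _ _ (lexx _) red.
rewrite !mule0 !lee_fin !normr_le0 z0 subr0.
by move=> /eqP -> /eqP ->.
Qed.

(** Existence for [a] comes from the estimates for [flip a], uniqueness from those for [a]. The
    bounds on [y] and [p] are sums of those for the data [(F, 0)] and [(0, G)]. *)
Lemma stable_of_estimates (K : stability_constants R) (a : form R V V) :
  nondegenerate a -> nondegenerate (flip a) ->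
  (forall NF z, 0 <= NF -> ZZ z -> (forall w, ZZ w -> a z w <= NF * `|w|) ->
    (`|z|%:E <= C1 K * NF%:E)%E) ->
  (forall eps, 0 <= eps -> (eps%:E < eps_0 K)%E ->
    reduced_estimates K a eps /\ reduced_estimates K (flip a) eps) ->
  stable_with s a D VV QQ K.
Proof.
move=> nd nd' hC1 est; rewrite /stable_with /= => F G eps dF dG e0 eK.
have [ea ea'] := est _ e0 eK.
have l0 (E : normedModType R) (A : set E) : linear_on A (fun=> 0 : R).
  by move=> *; rewrite mulr0 addr0.
have ndff : nondegenerate (flip (flip a)) by [].
have ex F1 G1 : linear_on VV F1 -> linear_on QQ G1 ->
    exists u p, saddle_solution s a D VV QQ eps F1 G1 u p.
  move=> lF lG; apply: saddle_exists => // u p.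
  exact: homogeneous_trivial nd' ndff ea'.
have [u1 [p1 S1]] := ex F (fun=> 0) dF.1 (l0 _ _).
have [u2 [p2 S2]] := ex (fun=> 0) G (l0 _ _) dG.1.
have [Vu1 _ _ _] := S1; have [Vu2 _ _ _] := S2.
have [z1 Zz1 Ty1] := Ztilde_decomposition nd' Vu1.
have [z2 Zz2 Ty2] := Ztilde_decomposition nd' Vu2.
have subE (x z : V) : x = z + (x - z) by rewrite addrC subrK.
have FN U v : U `<=` VV -> U v -> F v <= dual_norm U F * `|v|.
  by move=> UV Uv; apply: le_trans (ler_norm _) _; apply: (dual_normP fV UV dF).
have GN q : QQ q -> G q <= dual_norm QQ G * `|q|.
  by move=> Qq; apply: le_trans (ler_norm _) _; apply: (dual_normP fQ _ dG).
have [|q _||Ez1 r1] := reduced_of_solution (NF := dual_norm (Zh a) F) (NG := 0)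
    S1 Zz1 Ty1 (subE _ _).
- by move=> v; apply: FN => // w [].
- by rewrite mul0r.
- by [].
have [v _|//||Ez2 r2] := reduced_of_solution (NF := 0) (NG := dual_norm QQ G)
    S2 Zz2 Ty2 (subE _ _).
- by rewrite mul0r.
- exact: dual_norm_ge0.
(* The part in [ZZ] sees only the load, so for the data [(0, G)] the whole of [u2] lies in
   [Ztilde]. *)
have z20 : z2 = 0 by apply: nd => // w Zw; rewrite Ez2.
rewrite z20 subr0 in Ty2 r2 => {Ez2 Zz2 z20 z2}.
set y1 := u1 - z1 in Ty1 r1.
exists (u1 + u2, p1 + p2); split.
  split=> [|[u p] S] /=.
    have := saddle_solutionD S1 S2; congr saddle_solution.
      by apply/funext => v; rewrite addr0.
    by apply/funext => v; rewrite add0r.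
  have S12 : saddle_solution s a D VV QQ eps F G (u1 + u2) (p1 + p2).
    have := saddle_solutionD S1 S2; congr saddle_solution.
      by apply/funext => v; rewrite addr0.
    by apply/funext => v; rewrite add0r.
  have [] := homogeneous_trivial nd nd' ea (saddle_solutionB S12 S).
  by move=> /subr0_eq -> /subr0_eq ->.
have Ty := fin_dimD (fin_dim_Ztilde a) Ty1 Ty2.
exists (z1, y1 + u2); split.
  split=> [|[z y] [Zz Tyy]] /=; first by split=> //; rewrite /y1 addrA -subE.
  move=> E; have E' : z1 + (y1 + u2) = z + y by rewrite -E /y1 addrA -subE.
  (* The difference of two decompositions lies in both [ZZ] and [Ztilde], which meet only in 0. *)
  have zE : z1 - z = y - (y1 + u2).
    by rewrite -(addrK (y1 + u2) z1) E' addrAC (addrC z) addrK.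
  have d0 : z1 - z = 0.
    apply: (Ztilde_kernel0 nd); first exact: fin_dimB fin_dim_discrete_kernel _ _.
    by rewrite zE; apply: fin_dimB (fin_dim_Ztilde a) _ _.
  by move: (d0); rewrite zE => /subr0_eq ->; rewrite (subr0_eq d0).
have [] := ea.1 _ _ _ (dual_norm_ge0 _ _) r1.
have [] := ea.2 _ _ _ (dual_norm_ge0 _ _) r2.
move=> yG pG yF pF; split=> /=.
- apply: hC1 => // [|w Zw]; first exact: dual_norm_ge0.
  by rewrite Ez1 //; apply: FN => // x [].
- by apply: le_trans (leeD yF yG); rewrite -EFinD lee_fin ler_normD.
- by apply: le_trans (leeD pF pG); rewrite -EFinD lee_fin ler_normD.
Qed.

(** * Lifting, pressure and energy bounds *)

Section Bounds.
Variables (be Ma : R).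
Hypothesis be_gt0 : 0 < be.
Hypothesis Ma_ge0 : 0 <= Ma.
Hypothesis be_infsup : (be%:E <= infsup (fun q v => s (D v) q) QQ VV)%E.

Definition bounded_form (a : form R V V) : Prop :=
  forall u v, `|a u v| <= Ma * `|u| * `|v|.

(** The bounded lift [v] of [D y] has the same image as [y], so [y] is the projection of [v] onto
    [Ztilde], and [Ups] is paid once. *)
Lemma Ztilde_lift (a : form R V V) (Ups : R) (y : V) :
  nondegenerate a -> nondegenerate (flip a) -> 0 <= Ups ->
  projection_bound a Ups -> Zt a y -> be * `|y| <= Ups * `|D y|.
Proof.
move=> nd nd' U0 pb Ty; have [Vy _] := Ty.
have [v [Vv Dv bv]] :=
  bounded_lift mC mN sC sN fV fQ DV be_gt0 be_infsup (image_in Vy).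
have [z Zz Tv] := Ztilde_decomposition nd' Vv.
have yE : y = v - z.
  apply: subr0_eq; apply: (Ztilde_kernel0 nd); last first.
    exact: fin_dimB (fin_dim_Ztilde a) Ty Tv.
  apply/discrete_kernelE; split; first exact: fin_dimB fV Vy Tv.1.
  by rewrite !(linearB D) /= Dv ((discrete_kernelE z).1 Zz).2 subr0 subrr.
apply: (@le_trans _ _ (be * (Ups * `|v|))).
  by rewrite ler_pM2l // {1}yE pb.
by rewrite mulrCA ler_wpM2l.
Qed.

(** Extends the test space from [Zhat] to [VV]: the component of [v] in [ZZ] contributes nothing,
    because [a y] and [D] vanish there. *)
Lemma reduced_test (a : form R V V) (eps NF NG Ups : R) (y : V) (p : Q) :
  nondegenerate a -> projection_bound (flip a) Ups -> 0 <= NF ->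
  reduced_solution a eps NF NG y p ->
  forall v, VV v -> a y v + s (D v) p <= NF * (Ups * `|v|).
Proof.
move=> nd pb NF0 [Ty Qp hF _] v Vv.
have [z Zz Tv] := @Ztilde_decomposition (flip a) nd v Vv.
apply: (@le_trans _ _ (NF * `|v - z|)); last by rewrite ler_wpM2l // pb.
have Dvz : D (v - z) = D v.
  by rewrite linearB /= ((discrete_kernelE z).1 Zz).2 subr0.
by have := hF _ Tv; rewrite Dvz (linearBr a) /= (Ty.2 _ Zz) subr0.
Qed.

(* Testing with all of VV rather than with Zhat puts the factor Ups on the load
   only; hence the single power of Ups in C4. *)
Lemma pressure_bound (a : form R V V) (eps NF NG Ups : R) (y : V) (p : Q) :
  bounded_form a -> nondegenerate a -> 0 <= Ups ->
  projection_bound (flip a) Ups -> 0 <= NF ->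
  reduced_solution a eps NF NG y p -> be * `|p| <= NF * Ups + Ma * `|y|.
Proof.
move=> aM nd U0 pb NF0 S; have [_ Qp _ _] := S.
apply: infsup_le be_infsup Qp _ _; first by rewrite addr_ge0 // mulr_ge0.
move=> v Vv; have := reduced_test nd pb NF0 S Vv.
have := aM y v; rewrite ler_norml => /andP[h _].
by move: h; lra.
Qed.

(** The component [v] of [y] in [Zhat] is the right test: [y - v] lies in [ZZ], so [a y v = a y y]
    and [D v = D y = eps *: p]. *)
Lemma energy_load (a : form R V V) (eps NF : R) (y : V) (p : Q) :
  0 <= eps -> reduced_solution a eps NF 0 y p ->
  D y = eps *: p /\ forall v, Zh a v -> ZZ (y - v) ->
    a y y + eps * `|p| ^+ 2 <= NF * `|v|.
Proof.
move=> e0 [Ty Qp hF]; rewrite normr_le0 subr_eq0 => /eqP Dy.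
split=> // v Tv Zyv; apply: le_trans (hF v Tv).
have := Ty.2 _ Zyv; have := ((discrete_kernelE _).1 Zyv).2.
rewrite linearB /= linearBr /= => /subr0_eq <- /subr0_eq <-.
by rewrite Dy linearZl_LR /= sN.
Qed.

(** The two energy inequalities come from pairing [D y - eps *: p] with [p] and with [D y], and
    replacing [s (D y) p] by [- a y y]. *)
Lemma energy_divergence (a : form R V V) (eps NG : R) (y : V) (p : Q) :
  nondegenerate a -> 0 <= eps -> reduced_solution a eps 0 NG y p ->
  (exists Ups, projection_bound (flip a) Ups) ->
  [/\ forall v, VV v -> s (D v) p = - a y v,
    eps * `|p| ^+ 2 + a y y <= NG * `|p| &
    `|D y| ^+ 2 + eps * a y y <= NG * `|D y|].
Proof.
move=> nd e0 S [Ups pb]; have [Ty Qp hF hG] := S.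
have test v : VV v -> s (D v) p = - a y v.
  move=> Vv; have h1 := reduced_test nd pb (lexx 0) S Vv.
  (* [reduced_test] at [v] and at [- v] gives both inequalities of the equation. *)
  have VN : VV (- v).
    by rewrite -[- v]add0r; apply: fin_dimB => //; apply: fin_dim0.
  have := reduced_test nd pb (lexx 0) S VN.
  move: h1; rewrite !mul0r (linearN D) (linearNl s) (linearNr a) /=.
  by move=> h1 h2; apply/eqP; rewrite eq_le; apply/andP; split; lra.
have Dyp := test _ Ty.1.
have gx (x : Q) : `|s (D y - eps *: p) x| <= NG * `|x|.
  by apply: le_trans (dot_le sC sN _ _) _; apply: ler_wpM2r.
split=> //.
  have := gx p; rewrite linearBl linearZl_LR /= sN Dyp.
  by rewrite ler_norml => /andP[h _]; lra.
have := gx (D y); rewrite linearBl linearZl_LR /= sN (sC p) Dyp.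
by rewrite ler_norml => /andP[_ h]; lra.
Qed.

(** * Estimates for the reduced problem *)

Definition real_estimates (c2 c3 c4 : R) (a : form R V V) (eps : R) : Prop :=
  (forall NF y p, 0 <= NF -> reduced_solution a eps NF 0 y p ->
    `|y| <= eps * c2 * NF /\ `|p| <= c3 * NF) /\
  (forall NG y p, 0 <= NG -> reduced_solution a eps 0 NG y p ->
    `|y| <= c3 * NG /\ `|p| <= c4 * NG).

Lemma reduced_estimates_of_real (K : stability_constants R) (c2 c3 c4 : R)
    (a : form R V V) (eps : R) :
  C2 K eps = c2%:E -> C3 K eps = c3%:E -> C4 K eps = c4%:E ->
  real_estimates c2 c3 c4 a eps -> reduced_estimates K a eps.
Proof.
move=> E2 E3 E4 [hF hG]; rewrite /reduced_estimates E2 E3 E4.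
by split=> N y p N0 S; rewrite -!EFinM !lee_fin; [exact: hF | exact: hG].
Qed.

Lemma estimates_general (a : form R V V) (Ups eps rho : R) :
  bounded_form a -> nondegenerate a -> nondegenerate (flip a) -> 1 <= Ups ->
  projection_bound a Ups -> projection_bound (flip a) Ups ->
  0 <= eps -> 0 <= rho ->
  (1 - eps * Ma * (Ups / be) ^+ 2) * rho = 1 ->
  real_estimates (Ups ^+ 2 / be ^+ 2 * rho) (Ups / be * rho)
    (Ma * Ups / be ^+ 2 * rho) a eps.
Proof.
move=> aM nd nd' U1 pb pb' e0 rho0; set th := _ * _ ^+ 2 => rhoE.
have U0 : 0 <= Ups by apply: le_trans U1.
have be_neq0 : be != 0 by rewrite gt_eqF.
have k0 : 0 <= Ups / be by rewrite divr_ge0 // ltW.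
(* Inserting the two basic inequalities into each other yields the factor on the left; [1 <= Ups]
   enlarges it to [th], whose complement to 1 has inverse [rho]. *)
have thM t : 0 <= t -> eps * (Ups / be) * (Ma / be) * t <= th * t.
  move=> t0; rewrite (_ : th * t = eps * (Ups / be) * (Ma * (Ups / be)) * t).
    apply/ler_wpM2r/ler_wpM2l => //; first exact: mulr_ge0.
    by rewrite ler_wpM2l // ler_peMl // invr_ge0 ltW.
  by rewrite /th; ring.
have tilde y : Zt a y -> `|y| <= Ups / be * `|D y|.
  move=> Ty; rewrite -(ler_pM2l be_gt0).
  rewrite (le_trans (Ztilde_lift nd nd' U0 pb Ty)) //.
  by rewrite mulrA mulrCA divff // mulr1.
have press N N' y p : 0 <= N -> reduced_solution a eps N N' y p ->
    `|p| <= Ups / be * N + Ma / be * `|y|.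
  move=> N0 S; rewrite -(ler_pM2l be_gt0).
  rewrite (le_trans (pressure_bound aM nd U0 pb' N0 S)) // le_eqVlt.
  by apply/orP; left; apply/eqP; field.
(* In [y1], [|D y|] equals [eps * |p|] for a load and is at most [N + eps * |p|] for divergence
   data; each of [y1] and [p1] is then inserted into the other. *)
split=> N y p N0 S; have [Ty _ _ hG] := S; have y1 := tilde _ Ty.
  have p1 := press _ _ _ _ N0 S; have [Dy _] := energy_load e0 S.
  rewrite Dy normrZ ger0_norm // in y1.
  have ek0 : 0 <= eps * (Ups / be) by rewrite mulr_ge0.
  split.
    rewrite (_ : _ * N = eps * (Ups / be) ^+ 2 * N * rho); last by field.
    apply: le_of_contraction rhoE _ => //.
    have := thM _ (normr_ge0 y); have := ler_wpM2l ek0 p1; lra.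
  rewrite mulrAC; apply: le_of_contraction rhoE _ => //.
  have q0 : 0 <= Ma / be by rewrite divr_ge0 // ltW.
  have := thM _ (normr_ge0 p); have := ler_wpM2l q0 y1; lra.
have := press _ _ _ _ (lexx 0) S; rewrite mulr0 add0r => p1.
have Dle : `|D y| <= N + eps * `|p|.
  rewrite -[D y](subrK (eps *: p)) (le_trans (ler_normD _ _)) //.
  by rewrite normrZ (ger0_norm e0) lerD2r.
have := le_trans y1 (ler_wpM2l k0 Dle) => {}y1.
have q0 : 0 <= Ma / be by rewrite divr_ge0 // ltW.
have ek0 : 0 <= eps * (Ups / be) by rewrite mulr_ge0.
split.
  rewrite mulrAC; apply: le_of_contraction rhoE _ => //.
  have := thM _ (normr_ge0 y); have := ler_wpM2l ek0 p1; lra.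
rewrite (_ : _ * N = Ma / be * (Ups / be) * N * rho); last by field.
apply: le_of_contraction rhoE _ => //.
have := thM _ (normr_ge0 p); have := ler_wpM2l q0 y1; lra.
Qed.

Lemma Zhat_sym (a : form R V V) (y : V) :
  (forall u v, a u v = a v u) -> Zt a y -> Zh a y.
Proof. by move=> aC [Vy Ty]; split=> // z Zz; rewrite aC Ty. Qed.

(** Cauchy-Schwarz for [a] bounds [|a y v|] by [sqrt (Ma * a y y) * |v|], with neither [Ups] nor a
    coercivity constant. *)
Lemma pressure_energy_sym (a : form R V V) (y : V) (p : Q) :
  (forall u v, a u v = a v u) -> (forall u, VV u -> 0 <= a u u) ->
  bounded_form a -> VV y -> QQ p ->
  (forall v, VV v -> s (D v) p = - a y v) -> (be * `|p|) ^+ 2 <= Ma * a y y.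
Proof.
move=> aC a0 aM Vy Qp test; have y0 := a0 _ Vy.
suff h : be * `|p| <= Num.sqrt (Ma * a y y).
  rewrite -(sqr_sqrtr (_ : 0 <= Ma * a y y)) ?mulr_ge0 //.
  by rewrite ler_sqr ?nnegrE ?sqrtr_ge0 // mulr_ge0 // ltW.
apply: infsup_le be_infsup Qp (sqrtr_ge0 _) _ => v Vv; rewrite test //.
apply: le_trans (ler_norm _) _; rewrite normrN.
rewrite -ler_sqr ?nnegrE ?mulr_ge0 ?sqrtr_ge0 // exprMn sqr_sqrtr ?mulr_ge0 //.
rewrite real_normK ?num_real //.
apply: le_trans (cauchy_schwarz aC (fin_dim_comb fV) a0 Vy Vv) _.
have := aM v v; rewrite ler_norml => /andP[_ /(ler_wpM2l y0)]; lra.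
Qed.

(** By symmetry [y] lies in [Zhat] and may be tested with itself: [eps |p|^2 <= N |y|], while
    [be |y| <= Ups eps |p|] by the lift. Combining the two and cancelling [eps |p|] bounds [p] with
    no smallness of [eps]. *)
Lemma estimates_sym (a : form R V V) (Ups eps : R) :
  (forall u v, a u v = a v u) -> (forall u, VV u -> 0 <= a u u) ->
  bounded_form a -> nondegenerate a -> nondegenerate (flip a) -> 0 <= Ups ->
  projection_bound a Ups -> projection_bound (flip a) Ups -> 0 <= eps ->
  real_estimates (Ups ^+ 2 / be ^+ 2) (Ups / be)
    (Ma / (eps * Ma + be ^+ 2)) a eps.
Proof.
move=> aC a0 aM nd nd' U0 pb pb' e0.
have be_neq0 : be != 0 by rewrite gt_eqF.
split=> N y p N0 S; have [Ty Qp _ hG] := S;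
  have y1 := Ztilde_lift nd nd' U0 pb Ty.
  have p1 := pressure_bound aM nd U0 pb' N0 S; have [Dy en] := energy_load e0 S.
  have := en y (Zhat_sym aC Ty); rewrite subrr.
  move=> /(_ (fin_dim0 fin_dim_discrete_kernel)) {}en.
  rewrite Dy normrZ ger0_norm // in y1.
  have yy := a0 _ Ty.1.
  have P0 := normr_ge0 p.
  have bP : be * `|p| <= Ups * N.
    (* For [eps = 0] nothing can be cancelled; instead [y = 0], and [p1] loses its [Ma] term. *)
    have [ez|en0] := eqVneq eps 0.
      have y0 : `|y| = 0.
        apply/eqP; rewrite eq_le normr_ge0 andbT -(pmulr_rle0 _ be_gt0).
        by move: y1; rewrite ez; lra.
      by move: p1; rewrite y0; lra.
    have [->|Pn] := eqVneq `|p| 0; first by rewrite mulr0 mulr_ge0.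
    have ep : 0 < eps * `|p| by rewrite mulr_gt0 // lt_def ?en0 ?Pn.
    rewrite -(ler_pM2r ep).
    have := ler_wpM2l N0 y1; have := ler_wpM2l (ltW be_gt0) en.
    have := mulr_ge0 (ltW be_gt0) yy; lra.
  have b2 : 0 < be ^+ 2 by rewrite exprn_gt0.
  split; last first.
    by rewrite -(ler_pM2l be_gt0) (le_trans bP) // le_eqVlt; apply/orP; left;
      apply/eqP; field.
  rewrite -(ler_pM2l b2) [leRHS](_ : _ = Ups * eps * (Ups * N)); last by field.
  have := ler_wpM2l (ltW be_gt0) y1.
  have := ler_wpM2l (mulr_ge0 U0 e0) bP; lra.
have [] := energy_divergence nd e0 S; first by exists Ups.
move=> test en1 en2; have yy := a0 _ Ty.1; split.
  have DN : `|D y| <= N.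
    have [->//|Dn] := eqVneq `|D y| 0.
    have Dp : 0 < `|D y| by rewrite lt_def Dn normr_ge0.
    by rewrite -(ler_pM2r Dp); have := mulr_ge0 e0 yy; lra.
  rewrite -(ler_pM2l be_gt0) (le_trans y1) //.
  rewrite [leRHS](_ : _ = Ups * N); last by field.
  exact: ler_wpM2l.
by apply: le_energy en1 => //; apply: (pressure_energy_sym aC a0 aM Ty.1 Qp test).
Qed.

(** Common to both coercive cases: [c] controls the passage from [y] to its component [w] in [Zhat],
    and [M] relates pressure to energy. The nonsymmetric case takes [c := Ups] and [M := Ma * Ups],
    the symmetric one [c := 1] and [M := Ma]. *)
Lemma estimates_coercive (a : form R V V) (MD alt Ups c M eps : R) :
  0 < MD -> (forall v, `|D v| <= MD * `|v|) -> 0 < alt ->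
  (forall u, VV u -> alt * `|u| ^+ 2 <= a u u) ->
  bounded_form a -> nondegenerate a -> nondegenerate (flip a) -> 0 <= Ups ->
  projection_bound a Ups -> projection_bound (flip a) Ups -> 0 <= c -> 0 <= M ->
  0 <= eps ->
  (forall y, Zt a y -> exists w,
    [/\ Zh a w, ZZ (y - w), `|w| <= c * `|y| & alt * `|w| ^+ 2 <= a y y]) ->
  (forall y p, Zt a y -> QQ p -> (forall v, VV v -> s (D v) p = - a y v) ->
    (be * `|p|) ^+ 2 <= M * a y y) ->
  real_estimates (Ups ^+ 2 * c / (eps * alt * Ups ^+ 2 + be ^+ 2))
    (Ups * MD / Num.sqrt ((eps * alt * Ups ^+ 2 + be ^+ 2) *
                          (eps * alt + MD ^+ 2)))
    (M / (eps * M + be ^+ 2)) a eps.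
Proof.
move=> MD0 DM alt0 ac aM nd nd' U0 pb pb' c0 M0 e0 hat pe.
have ea0 : 0 <= eps * alt by rewrite mulr_ge0 // ltW.
have A0 : 0 < eps * alt * Ups ^+ 2 + be ^+ 2.
  by rewrite ltr_wpDl ?exprn_gt0 // mulr_ge0 // sqr_ge0.
have B0 : 0 < eps * alt + MD ^+ 2 by rewrite ltr_wpDl ?exprn_gt0.
have S0 : 0 < Num.sqrt ((eps * alt * Ups ^+ 2 + be ^+ 2) * (eps * alt + MD ^+ 2)).
  by rewrite sqrtr_gt0 mulr_gt0.
have qb v : be * `|v| <= Ups * `|D v| -> _ := fun h =>
  quotient_bound (normr_ge0 v) (normr_ge0 (D v)) ea0 (ltW be_gt0) U0 (ltW MD0)
    h (DM v).
split=> N y p N0 S; have [Ty Qp _ hG] := S;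
  have y1 := Ztilde_lift nd nd' U0 pb Ty.
  have p1 := pressure_bound aM nd U0 pb' N0 S; have [Dy en] := energy_load e0 S.
  have [w [Tw Zyw wy wa]] := hat _ Ty; have {}en := en w Tw Zyw.
  have w1 : be * `|w| <= Ups * `|D w| :=
    @Ztilde_lift (flip a) _ _ nd' nd U0 pb' Tw.
  have Dw : `|D w| = eps * `|p|.
    have := ((discrete_kernelE _).1 Zyw).2; rewrite linearB /= => /subr0_eq <-.
    by rewrite Dy normrZ ger0_norm.
  have qw := qb w w1; rewrite Dw in w1 qw.
  rewrite Dy normrZ ger0_norm // in y1.
  have P0 := normr_ge0 p; have x0 := normr_ge0 y.
  split.
    (* The energy bound is scaled by [eps * Ups ^+ 2]: its coercive term gives the first summand of
       the denominator, its pressure term dominates [(be * |y|) ^+ 2], and one [|y|] cancels. *)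
    rewrite mulrA mulrAC ler_pdivlMr //.
    have [->|yn] := eqVneq `|y| 0; first by rewrite mul0r !mulr_ge0 ?sqr_ge0.
    have yp : 0 < `|y| by rewrite lt_def yn.
    rewrite -(ler_pM2r yp).
    have h1 : (be * `|y|) ^+ 2 <= (Ups * (eps * `|p|)) ^+ 2.
      by rewrite ler_sqr ?nnegrE ?mulr_ge0 // ltW.
    have h2 : alt * `|y| ^+ 2 + eps * `|p| ^+ 2 <= N * (c * `|y|).
      by have := ac _ Ty.1; have := ler_wpM2l N0 wy; lra.
    have := ler_wpM2l (mulr_ge0 e0 (sqr_ge0 Ups)) h2; move: h1.
    rewrite !exprMn; lra.
  rewrite mulrAC ler_pdivlMr //.
  have [ez|en0] := eqVneq eps 0.
    have y0 : `|y| = 0.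
      apply/eqP; rewrite eq_le normr_ge0 andbT -(pmulr_rle0 _ be_gt0).
      by move: y1; rewrite ez; lra.
    (* For [eps = 0] the square root is [be * MD]. *)
    rewrite ez !mul0r !add0r -exprMn sqrtr_sqr ger0_norm; last first.
      by rewrite mulr_ge0 ?(ltW be_gt0) // ltW.
    move: p1; rewrite y0 mulr0 addr0 => /(ler_wpM2r (ltW MD0)); lra.
  have [->|Pn] := eqVneq `|p| 0; first by rewrite mul0r !mulr_ge0 // ltW.
  have ep : 0 < eps by rewrite lt_def en0.
  have wp : 0 < `|w|.
    rewrite lt_def normr_ge0 andbT; apply: contra_neq Pn => wz.
    have := DM w; rewrite Dw wz mulr0 => h.
    by apply/eqP; rewrite eq_le P0 andbT -(pmulr_rle0 _ ep).
  (* [quotient_bound] is used at [w], where [|D w| = eps * |p|]; the energy inequality bounds its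
     right-hand side, and [eps * |w|] cancels. *)
  rewrite -(ler_pM2l (mulr_gt0 wp ep)) mulrA -(mulrA `|w|).
  apply: le_trans qw _.
  have h : eps * alt * `|w| ^+ 2 + (eps * `|p|) ^+ 2 <= eps * (N * `|w|).
    have : alt * `|w| ^+ 2 + eps * `|p| ^+ 2 <= N * `|w| by lra.
    by move=> /(ler_wpM2l e0); rewrite exprMn; lra.
  have := ler_wpM2l (mulr_ge0 U0 (ltW MD0)) h; lra.
have [] := energy_divergence nd e0 S; first by exists Ups.
move=> test en1 en2; have yy := ac _ Ty.1; split.
  (* For divergence data the quotient bound is used at [y] itself and closed by [en2]. *)
  have qy := qb y y1.
  rewrite mulrAC ler_pdivlMr //.
  have [Dz|Dn] := eqVneq `|D y| 0.
    have -> : `|y| = 0.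
      apply/eqP; rewrite eq_le normr_ge0 andbT -(pmulr_rle0 _ be_gt0).
      by move: y1; rewrite Dz mulr0.
    by rewrite mul0r !mulr_ge0 // ltW.
  have Dp : 0 < `|D y| by rewrite lt_def Dn normr_ge0.
  rewrite -(ler_pM2r Dp) mulrAC; apply: le_trans qy _.
  rewrite -(mulrA (Ups * MD)) ler_wpM2l ?mulr_ge0 // ?(ltW MD0) //.
  by have := ler_wpM2l e0 yy; lra.
apply: le_energy en1 => //; exact: pe.
Qed.

End Bounds.

(** * Stability *)

Lemma nondegenerate_infsup (a : form R V V) (al : R) :
  0 < al -> (al%:E <= infsup a ZZ ZZ)%E -> nondegenerate a.
Proof.
move=> al0 ala z Zz kz; apply/eqP; rewrite -normr_le0 -(pmulr_rle0 _ al0).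
by apply: infsup_le ala Zz (lexx 0) _ => w Zw; rewrite kz // mul0r.
Qed.

Lemma nondegenerate_coercive (a : form R V V) (alt : R) :
  0 < alt -> (forall z, ZZ z -> alt * `|z| ^+ 2 <= a z z) -> nondegenerate a.
Proof.
move=> alt0 ac z Zz kz; have := ac _ Zz; rewrite kz // pmulr_rle0 //.
by move=> h; apply/eqP; rewrite -normr_eq0 -sqrf_eq0 eq_le h sqr_ge0.
Qed.

Lemma Ztilde_formE (a : form R V V) (u z w : V) :
  Zt a (u - z) -> ZZ w -> a z w = a u w.
Proof.
by move=> [_ h] Zw; have := h w Zw; rewrite linearBl /= => /subr0_eq.
Qed.

(** The inf-sup condition controls [z]; [u - z] is reached by the triangle inequality, whence the
    summand 1. *)
Lemma projection_bound_infsup (a : form R V V) (Ma al : R) :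
  0 <= Ma -> bounded_form Ma a -> 0 < al -> (al%:E <= infsup a ZZ ZZ)%E ->
  projection_bound a (1 + Ma / al).
Proof.
move=> Ma0 aM al0 ala u z Vu Zz Tuz.
have h : al * `|z| <= Ma * `|u|.
  apply: infsup_le ala Zz _ _; first exact: mulr_ge0.
  move=> w Zw; rewrite (Ztilde_formE Tuz Zw).
  exact: le_trans (ler_norm _) (aM _ _).
apply: le_trans (ler_normB _ _) _; rewrite mulrDl mul1r lerD2l.
by rewrite mulrAC ler_pdivlMr // mulrC.
Qed.

(** For [y := u - z], [a y y = a y u] because [a y z = 0]; coercivity acts on [y] directly, without
    the triangle inequality. *)
Lemma projection_bound_coercive (a : form R V V) (Ma alt : R) :
  0 <= Ma -> bounded_form Ma a -> 0 < alt ->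
  (forall u, VV u -> alt * `|u| ^+ 2 <= a u u) ->
  projection_bound a (Ma / alt).
Proof.
move=> Ma0 aM alt0 ac u z Vu Zz [Vy Ty].
rewrite mulrAC ler_pdivlMr // mulrC.
have [->|yn] := eqVneq `|u - z| 0.
  by rewrite mulr0 mulr_ge0.
have yp : 0 < `|u - z| by rewrite lt_def yn normr_ge0.
rewrite -(ler_pM2r yp) -mulrA -expr2 (le_trans (ac _ Vy)) //.
have -> : a (u - z) (u - z) = a (u - z) u.
  by rewrite (linearBr a) /= (Ty _ Zz) subr0.
by rewrite mulrAC; apply: le_trans (ler_norm _) (aM _ _).
Qed.

(** The equation makes [u - v] orthogonal to [v] for [a]; Cauchy-Schwarz gives
    [(a v v) ^+ 2 <= a u u * a v v], and one factor cancels. *)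
Lemma energy_projection (a : form R V V) (u v : V) :
  (forall u v, a u v = a v u) -> (forall u, VV u -> 0 <= a u u) ->
  VV u -> VV v -> a v v = a u v -> a v v <= a u u.
Proof.
move=> aC a0 Vu Vv E; have := cauchy_schwarz aC (fin_dim_comb fV) a0 Vu Vv.
rewrite -E expr2; have := a0 _ Vv; rewrite le_eqVlt => /orP[/eqP <- _|vp].
  exact: a0.
by rewrite ler_pM2r.
Qed.

(** Coercivity is given on [ZZ], so the energy argument is applied to [z], and the triangle
    inequality adds the 1. *)
Lemma projection_bound_semicoercive (a : form R V V) (Ma alt : R) :
  0 <= Ma -> bounded_form Ma a -> 0 < alt ->
  (forall u v, a u v = a v u) -> (forall u, VV u -> 0 <= a u u) ->
  (forall z, ZZ z -> alt * `|z| ^+ 2 <= a z z) ->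
  projection_bound a (1 + Num.sqrt (Ma / alt)).
Proof.
move=> Ma0 aM alt0 aC a0 ac u z Vu Zz Tuz; have [Vz _] := Zz.
apply: le_trans (ler_normB _ _) _; rewrite mulrDl mul1r lerD2l.
apply: le_sqrt_ratio (ac _ Zz) _ => //.
apply: le_trans (energy_projection aC a0 Vu Vz (Ztilde_formE Tuz Zz)) _.
by rewrite expr2 mulrA; apply: le_trans (ler_norm _) (aM _ _).
Qed.

(** Coercivity on [VV] lets the energy argument act on [u - z], the complementary orthogonal
    projection. *)
Lemma projection_bound_energy (a : form R V V) (Ma alt : R) :
  0 <= Ma -> bounded_form Ma a -> 0 < alt ->
  (forall u v, a u v = a v u) ->
  (forall u, VV u -> alt * `|u| ^+ 2 <= a u u) ->
  projection_bound a (Num.sqrt (Ma / alt)).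
Proof.
move=> Ma0 aM alt0 aC ac u z Vu Zz [Vy Ty].
have a0 x : VV x -> 0 <= a x x.
  by move=> Vx; rewrite (le_trans _ (ac _ Vx)) // mulr_ge0 ?sqr_ge0 // ltW.
apply: le_sqrt_ratio (ac _ Vy) _ => //.
have E : a (u - z) (u - z) = a u (u - z).
  by rewrite {1}(linearBl a) /= (aC z) (Ty _ Zz) subr0.
apply: le_trans (energy_projection aC a0 Vu Vy E) _.
by rewrite expr2 mulrA; apply: le_trans (ler_norm _) (aM _ _).
Qed.

(** Covers [QQ = {0}], where [beX] is [+oo]: [y] lies in both [ZZ] and [Ztilde], so both unknowns
    vanish and the signs of the constants suffice. *)
Lemma reduced_estimates_trivial (K : stability_constants R) (a : form R V V)
    (eps : R) :
  (forall q, QQ q -> q = 0) -> nondegenerate a -> 0 <= eps ->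
  (0 <= C2 K eps)%E -> (0 <= C3 K eps)%E -> (0 <= C4 K eps)%E ->
  reduced_estimates K a eps.
Proof.
move=> Q0 nd e0 c2 c3 c4.
have yp N N' y p : reduced_solution a eps N N' y p -> y = 0 /\ p = 0.
  move=> [Ty Qp _ _]; split; last exact: Q0.
  apply: (Ztilde_kernel0 nd _ Ty); apply/discrete_kernelE.
  by split; [case: Ty | apply/Q0/image_in; case: Ty].
split=> N y p N0 /yp[-> ->]; rewrite !normr0.
  by split; rewrite !mule_ge0 ?lee_fin.
by split; rewrite !mule_ge0 ?lee_fin.
Qed.

(** Separates the degenerate case [QQ = {0}] from the one where the estimates can be done with real
    constants. *)
Lemma infsup_finite (MD : R) (beX : \bar R) :
  (forall v, `|D v| <= MD * `|v|) ->
  beX = infsup (fun q v => s (D v) q) QQ VV -> (0 < beX)%E ->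
  (forall q, QQ q -> q = 0) \/ 0 < MD /\ exists2 be, beX = be%:E & 0 < be.
Proof.
move=> DM beE be0.
have [Q0|/existsNP[q /not_implyP[Qq q0]]] := pselect (forall q, QQ q -> q = 0).
  by left.
have [v Vv Dv] : (D @` VV) q by rewrite DV.
have v0 : v != 0 by apply: contra_notN q0 => /eqP v0; rewrite -Dv v0 linear0.
have vp : 0 < `|v| by rewrite normr_gt0.
have qp : 0 < `|q| by rewrite normr_gt0; apply/eqP.
right; split.
  by rewrite -(pmulr_lgt0 _ vp) (lt_le_trans qp) // -Dv.
case: beX beE be0 => [be _||//]; first by rewrite lte_fin; exists be.
move=> beE _.
have M0 : 0 <= MD by rewrite -(pmulr_lge0 _ vp) (le_trans _ (DM v)).
(* If [beX] were [+oo], the lift [w] of [q] with constant [MD + 1] would satisfy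
   [(MD + 1) |w| <= |D w| <= MD |w|], forcing [q = 0]. *)
have [||w [_ Dw]] := @bounded_lift _ _ _ m s D VV QQ (MD + 1)
  mC mN sC sN fV fQ DV _ _ q Qq.
- by rewrite ltr_wpDl.
- by rewrite -beE leey.
have := DM w; rewrite Dw => h1 /(le_trans)/(_ h1).
rewrite mulrDl mul1r gerDl normr_le0 => /eqP w0.
by case: q0; rewrite -Dw w0 linear0.
Qed.

Lemma infsup_real (b : V -> V -> R) (alX : \bar R) :
  alX = infsup b ZZ ZZ -> (0 < alX)%E ->
  exists2 al : R, 0 < al & (al%:E <= infsup b ZZ ZZ)%E.
Proof.
case: alX => [al||//] E; first by rewrite lte_fin => al0; exists al; rewrite -?E.
by exists 1; rewrite // -E leey.
Qed.

(** * The four structural cases *)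

Lemma stable_general (a : form R V V) (MD Ma : R) (alX beX : \bar R) :
  (forall v, `|D v| <= MD * `|v|) -> 0 <= Ma -> bounded_form Ma a ->
  alX = infsup a ZZ ZZ -> alX = infsup (flip a) ZZ ZZ -> (0 < alX)%E ->
  beX = infsup (fun q v => s (D v) q) QQ VV -> (0 < beX)%E ->
  stable_with s a D VV QQ (constants_general Ma alX beX).
Proof.
move=> DM Ma0 aM alE alE' al0 beE be0.
have aM' : bounded_form Ma (flip a) by move=> u v; rewrite mulrAC aM.
have [al1 al1p al1E] := infsup_real alE al0.
have [al2 al2p al2E] := infsup_real alE' al0.
have nd := nondegenerate_infsup al1p al1E.
have nd' : nondegenerate (flip a) := nondegenerate_infsup al2p al2E.
have ndff : nondegenerate (flip (flip a)) := nd.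
have [Ups [U1 UE pb pb' hC]] : exists Ups : R, [/\ 1 <= Ups,
    (1 + Ma%:E / alX)%E = Ups%:E, projection_bound a Ups,
    projection_bound (flip a) Ups &
    forall NF z, 0 <= NF -> ZZ z -> (forall w, ZZ w -> a z w <= NF * `|w|) ->
      (`|z|%:E <= alX^-1 * NF%:E)%E].
  clear al1p al1E al2p al2E al1 al2.
  case: alX alE alE' al0 => [al||//] E E'.
    rewrite lte_fin => al0; exists (1 + Ma / al); split.
    - by rewrite lerDl divr_ge0 // ltW.
    - by rewrite inver gt_eqF.
    - by apply: projection_bound_infsup => //; rewrite E.
    - by apply: projection_bound_infsup => //; rewrite E'.
    - move=> NF z N0 Zz h; rewrite inver gt_eqF // -EFinM lee_fin.
      by rewrite mulrC ler_pdivlMr // mulrC; apply: infsup_le Zz N0 h; rewrite E.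
  (* Here [alX = +oo]: an inf-sup constant [Ma + 1] exceeds the bound [Ma] on [a], so [ZZ] is
     trivial. [Ups] is then 1, since the inverse of [+oo] is 0. *)
  move=> _; have Z0 z : ZZ z -> z = 0.
    move=> Zz; have h : (Ma + 1) * `|z| <= Ma * `|z|.
      apply: (@infsup_le _ _ _ a ZZ ZZ) => //; first by rewrite -E leey.
        exact: mulr_ge0.
      by move=> w _; apply: le_trans (ler_norm _) (aM _ _).
    by move: h; rewrite mulrDl mul1r gerDl normr_le0 => /eqP.
  exists 1; split=> //.
  - by rewrite invey mule0 adde0.
  - by move=> u z Vu /Z0 -> _; rewrite subr0 mul1r.
  - by move=> u z Vu /Z0 -> _; rewrite subr0 mul1r.
  - by move=> NF z _ /Z0 -> _; rewrite normr0 invey mul0e.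
apply: stable_of_estimates => // eps e0.
have U0 : 0 < Ups by apply: lt_le_trans U1.
have Un : Ups != 0 by rewrite gt_eqF.
have [Q0|[MD0 [be beR be_gt0]]] := infsup_finite DM beE be0.
  have r0 := eps_ratio_ge0 e0.
  have be00 := ltW be0; have U00 : (0 <= Ups%:E)%E by rewrite lee_fin ltW.
  move=> e1l; have {}r0 := r0 _ e1l; rewrite /= UE in r0.
  by split; apply: reduced_estimates_trivial => //=; rewrite UE;
    do ?[apply: mule_ge0 => //]; rewrite ?inve_ge0 ?mule_ge0 ?lee_fin.
have ben : be != 0 by rewrite gt_eqF.
have beI : (be%:E <= infsup (fun q v => s (D v) q) QQ VV)%E by rewrite -beE beR.
rewrite /= UE beR; set e1 := (X in (_ < X)%E) => e1l.
have e1M : e1 = (Ma%:E^-1 * ((be / Ups) ^+ 2)%:E)%E.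
  by rewrite /e1 [Ups%:E^-1%E]inver (negPf Un) -!EFinM.
have [rho [rho0 rhoE rE]] : exists rho : R, [/\ 0 <= rho,
   (1 - eps * Ma * (Ups / be) ^+ 2) * rho = 1 & eps_ratio e1 eps = rho%:E].
  have k0 : 0 < (be / Ups) ^+ 2 by rewrite exprn_gt0 ?divr_gt0.
  (* For [Ma = 0] the inverse is [+oo], so [eps_0] is infinite and the ratio is 1 by definition. *)
  have [M0|Mn] := eqVneq Ma 0.
    exists 1; split=> //; first by rewrite M0 mulr0 mul0r subr0 mulr1.
    by rewrite e1M M0 inve0 gt0_mulye // lte_fin.
  (* The real value of [eps_0]; the contraction factor is [eps / r], so [rho] is [r / (r - eps)]. *)
  pose r := Ma^-1 * (be / Ups) ^+ 2.
  have e1E : e1 = r%:E by rewrite e1M inver (negPf Mn) -EFinM.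
  have re : 0 < r - eps by move: e1l; rewrite e1E lte_fin subr_gt0.
  have rp : 0 < r by rewrite mulr_gt0 // invr_gt0 lt_def Mn.
  exists (r / (r - eps)); split; last by rewrite e1E.
    by rewrite divr_ge0 // ltW.
  have -> : eps * Ma * (Ups / be) ^+ 2 = eps / r.
    by rewrite /r; field; rewrite Mn Un ben.
  by field; rewrite !gt_eqF.
have est (b : form R V V) :
    bounded_form Ma b -> nondegenerate b -> nondegenerate (flip b) ->
    projection_bound b Ups -> projection_bound (flip b) Ups ->
    reduced_estimates (constants_general Ma alX be%:E) b eps.
  move=> bM n n' p p'.
  apply: reduced_estimates_of_real
    (estimates_general be_gt0 Ma0 beI bM n n' U1 p p' e0 rho0 rhoE).
  - by rewrite /= UE rE -!EFinM inver mulf_eq0 (negPf ben) -!EFinM.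
  - by rewrite /= UE rE inver (negPf ben) -!EFinM.
  - by rewrite /= UE rE -!EFinM inver mulf_eq0 (negPf ben) -!EFinM.
by split; apply: est.
Qed.

Lemma kernel_bound_coercive (a : form R V V) (alt NF : R) (z : V) :
  0 < alt -> 0 <= NF -> (forall z, ZZ z -> alt * `|z| ^+ 2 <= a z z) ->
  ZZ z -> (forall w, ZZ w -> a z w <= NF * `|w|) -> `|z| <= alt^-1 * NF.
Proof.
move=> alt0 N0 ac Zz h; rewrite mulrC ler_pdivlMr //.
have [->|zn] := eqVneq `|z| 0; first by rewrite mul0r.
have zp : 0 < `|z| by rewrite lt_def zn normr_ge0.
by rewrite -(ler_pM2r zp) mulrAC -expr2 mulrC (le_trans (ac _ Zz)) // h.
Qed.

Lemma stable_semicoercive (a : form R V V) (MD Ma alt : R) (beX : \bar R) :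
  (forall v, `|D v| <= MD * `|v|) -> 0 <= Ma -> bounded_form Ma a ->
  beX = infsup (fun q v => s (D v) q) QQ VV -> (0 < beX)%E ->
  structure_A1 s a D VV QQ alt ->
  stable_with s a D VV QQ (constants_A1 Ma alt beX).
Proof.
move=> DM Ma0 aM beE be0 [aC alt0 a0 ac].
have aM' : bounded_form Ma (flip a) by move=> u v; rewrite mulrAC aM.
have aC' u v : flip a u v = flip a v u by apply: aC.
have a0' u : VV u -> 0 <= flip a u u by apply: a0.
have ac' z : ZZ z -> alt * `|z| ^+ 2 <= flip a z z by apply: ac.
have nd := nondegenerate_coercive alt0 ac.
have nd' := nondegenerate_coercive alt0 ac'.
have ndff : nondegenerate (flip (flip a)) := nd.
have pb := projection_bound_semicoercive Ma0 aM alt0 aC a0 ac.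
have pb' := projection_bound_semicoercive Ma0 aM' alt0 aC' a0' ac'.
have pbff : projection_bound (flip (flip a)) (1 + Num.sqrt (Ma / alt)) := pb.
have U0 : 0 <= 1 + Num.sqrt (Ma / alt) by rewrite addr_ge0 ?sqrtr_ge0.
apply: stable_of_estimates => // [NF z N0 Zz h|eps e0 _].
  by rewrite -EFinM lee_fin; apply: kernel_bound_coercive alt0 N0 ac Zz h.
have [Q0|[MD0 [be beR be_gt0]]] := infsup_finite DM beE be0.
  have be00 := ltW be0.
  by split; apply: reduced_estimates_trivial => //=;
    rewrite ?mule_ge0 ?inve_ge0 ?adde_ge0 ?mule_ge0 ?lee_fin ?mulr_ge0 ?sqr_ge0.
have beI : (be%:E <= infsup (fun q v => s (D v) q) QQ VV)%E by rewrite -beE beR.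
have b2 : be * be != 0 by rewrite mulf_neq0 ?gt_eqF.
have d0 : eps * Ma + be * be != 0.
  by rewrite gt_eqF // ltr_wpDl ?mulr_ge0 ?mulr_gt0.
have est (b : form R V V) :
    (forall u v, b u v = b v u) -> (forall u, VV u -> 0 <= b u u) ->
    bounded_form Ma b -> nondegenerate b -> nondegenerate (flip b) ->
    projection_bound b (1 + Num.sqrt (Ma / alt)) ->
    projection_bound (flip b) (1 + Num.sqrt (Ma / alt)) ->
    reduced_estimates (constants_A1 Ma alt be%:E) b eps.
  move=> bC b0 bM n n' p p'.
  apply: reduced_estimates_of_real
    (estimates_sym be_gt0 Ma0 beI bC b0 bM n n' U0 p p' e0) => /=.
  - by rewrite -EFinM inver (negPf b2) -EFinM.
  - by rewrite inver gt_eqF // -EFinM.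
  - by rewrite -EFinM -EFinD inver (negPf d0) -EFinM.
by rewrite beR; split; apply: est.
Qed.

Lemma stable_coercive_nonsym (a : form R V V) (MD Ma alt : R) (beX : \bar R) :
  0 <= MD -> (forall v, `|D v| <= MD * `|v|) -> 0 <= Ma -> bounded_form Ma a ->
  beX = infsup (fun q v => s (D v) q) QQ VV -> (0 < beX)%E ->
  structure_A2 a VV alt ->
  stable_with s a D VV QQ (constants_A2 Ma MD alt beX).
Proof.
move=> MD_ge0 DM Ma0 aM beE be0 [alt0 ac].
have aM' : bounded_form Ma (flip a) by move=> u v; rewrite mulrAC aM.
have ac' u : VV u -> alt * `|u| ^+ 2 <= flip a u u by apply: ac.
have acZ z : ZZ z -> alt * `|z| ^+ 2 <= a z z by move=> [Vz _]; apply: ac.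
have acZ' z : ZZ z -> alt * `|z| ^+ 2 <= flip a z z by apply: acZ.
have nd := nondegenerate_coercive alt0 acZ.
have nd' := nondegenerate_coercive alt0 acZ'.
have ndff : nondegenerate (flip (flip a)) := nd.
have pb := projection_bound_coercive Ma0 aM alt0 ac.
have pb' := projection_bound_coercive Ma0 aM' alt0 ac'.
have pbff : projection_bound (flip (flip a)) (Ma / alt) := pb.
have U0 : 0 <= Ma / alt by rewrite divr_ge0 // ltW.
apply: stable_of_estimates => // [NF z N0 Zz h|eps e0 _].
  by rewrite -EFinM lee_fin; apply: kernel_bound_coercive alt0 N0 acZ Zz h.
have ea0 : 0 <= eps * alt by rewrite mulr_ge0 // ltW.
have [Q0|[MD0 [be beR be_gt0]]] := infsup_finite DM beE be0.
  have be00 := ltW be0; have al0 := ltW alt0.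
  have ai0 : 0 <= alt^-1 by rewrite invr_ge0.
  by split; apply: reduced_estimates_trivial => //=;
    rewrite ?mule_ge0 ?inve_ge0 ?sqrte_ge0 ?adde_ge0 ?mule_ge0 ?lee_fin
      ?mulr_ge0 ?exprn_ge0.
have beI : (be%:E <= infsup (fun q v => s (D v) q) QQ VV)%E by rewrite -beE beR.
have MU0 : 0 <= Ma * (Ma / alt) by rewrite mulr_ge0.
have d2 : 0 < eps * alt * (Ma / alt) ^+ 2 + be * be.
  by rewrite ltr_wpDl ?mulr_gt0 // mulr_ge0 ?sqr_ge0.
have d3 : 0 < Num.sqrt ((eps * alt * (Ma / alt) ^+ 2 + be * be) *
    (eps * alt + MD ^+ 2)).
  by rewrite sqrtr_gt0 mulr_gt0 // ltr_wpDl ?exprn_gt0.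
have d4 : 0 < eps * Ma * (Ma / alt) + be * be.
  by rewrite ltr_wpDl ?mulr_gt0 // mulr_ge0 // mulr_ge0.
have est (b : form R V V) : (forall u, VV u -> alt * `|u| ^+ 2 <= b u u) ->
    bounded_form Ma b -> nondegenerate b -> nondegenerate (flip b) ->
    projection_bound b (Ma / alt) -> projection_bound (flip b) (Ma / alt) ->
    reduced_estimates (constants_A2 Ma MD alt be%:E) b eps.
  move=> bc bM n n' p p'.
  have hat y : Zt b y -> exists w, [/\ Zh b w, ZZ (y - w),
      `|w| <= Ma / alt * `|y| & alt * `|w| ^+ 2 <= b y y].
    move=> [Vy Ty]; have [z Zz Tw] := @Ztilde_decomposition (flip b) n y Vy.
    (* For [w := y - z], [b z w = 0] and [b y z = 0] give [b w w = b y y]. *)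
    exists (y - z); split; [exact: Tw | by rewrite subKr | exact: p' |].
    rewrite (le_trans (bc _ Tw.1)) //.
    have bz : b z (y - z) = 0 := Tw.2 _ Zz.
    by rewrite (linearBl b) /= bz subr0 (linearBr b) /= (Ty _ Zz) subr0.
  have pe y q : Zt b y -> QQ q -> (forall v, VV v -> s (D v) q = - b y v) ->
      (be * `|q|) ^+ 2 <= Ma * (Ma / alt) * b y y.
    move=> [Vy _] Qq test.
    have h : be * `|q| <= Ma * `|y|.
      apply: infsup_le beI Qq _ _; first exact: mulr_ge0.
      move=> v Vv; rewrite test //; apply: le_trans (ler_norm _) _.
      by rewrite normrN bM.
    apply: (@le_trans _ _ ((Ma * `|y|) ^+ 2)).
      by rewrite ler_sqr ?nnegrE ?mulr_ge0 // ltW.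
    (* Coercivity trades [|y| ^+ 2] for [b y y / alt], which leaves the factor [Ma * Ups]. *)
    rewrite exprMn (_ : Ma ^+ 2 * _ = Ma * (Ma / alt) * (alt * `|y| ^+ 2)).
      by rewrite ler_wpM2l // bc.
    by field; rewrite gt_eqF.
  apply: reduced_estimates_of_real (estimates_coercive be_gt0 Ma0 beI MD0 DM
    alt0 bc bM n n' U0 p p' U0 MU0 e0 hat pe) => /=.
  - rewrite -EFinM -EFinD inver gt_eqF // -EFinM.
    by congr (_ / _)%:E; rewrite -exprSr.
  - by rewrite inver gt_eqF // -EFinM.
  - by rewrite -EFinM -EFinD inver gt_eqF // -EFinM [eps * (Ma * _)]mulrA.
by rewrite beR; split; apply: est.
Qed.

Lemma stable_coercive_sym (a : form R V V) (MD Ma alt : R) (beX : \bar R) :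
  0 <= MD -> (forall v, `|D v| <= MD * `|v|) -> 0 <= Ma -> bounded_form Ma a ->
  beX = infsup (fun q v => s (D v) q) QQ VV -> (0 < beX)%E ->
  structure_A3 a VV alt ->
  stable_with s a D VV QQ (constants_A3 Ma MD alt beX).
Proof.
move=> MD_ge0 DM Ma0 aM beE be0 [aC [alt0 ac]].
have aM' : bounded_form Ma (flip a) by move=> u v; rewrite mulrAC aM.
have aC' u v : flip a u v = flip a v u by apply: aC.
have ac' u : VV u -> alt * `|u| ^+ 2 <= flip a u u by apply: ac.
have acZ z : ZZ z -> alt * `|z| ^+ 2 <= a z z by move=> [Vz _]; apply: ac.
have acZ' z : ZZ z -> alt * `|z| ^+ 2 <= flip a z z by apply: acZ.
have nd := nondegenerate_coercive alt0 acZ.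
have nd' := nondegenerate_coercive alt0 acZ'.
have ndff : nondegenerate (flip (flip a)) := nd.
have pb := projection_bound_energy Ma0 aM alt0 aC ac.
have pb' := projection_bound_energy Ma0 aM' alt0 aC' ac'.
have pbff : projection_bound (flip (flip a)) (Num.sqrt (Ma / alt)) := pb.
have q0 : 0 <= Ma / alt by rewrite divr_ge0 // ltW.
have U0 := sqrtr_ge0 (Ma / alt).
have U2 : Num.sqrt (Ma / alt) ^+ 2 = Ma / alt by rewrite sqr_sqrtr.
apply: stable_of_estimates => // [NF z N0 Zz h|eps e0 _].
  by rewrite -EFinM lee_fin; apply: kernel_bound_coercive alt0 N0 acZ Zz h.
have ea0 : 0 <= eps * alt by rewrite mulr_ge0 // ltW.
have [Q0|[MD0 [be beR be_gt0]]] := infsup_finite DM beE be0.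
  have be00 := ltW be0.
  by split; apply: reduced_estimates_trivial => //=;
    rewrite ?mule_ge0 ?inve_ge0 ?sqrte_ge0 ?adde_ge0 ?mule_ge0 ?lee_fin
      ?mulr_ge0 ?exprn_ge0.
have beI : (be%:E <= infsup (fun q v => s (D v) q) QQ VV)%E by rewrite -beE beR.
have d3 : 0 < Num.sqrt ((eps * alt * Num.sqrt (Ma / alt) ^+ 2 + be * be) *
    (eps * alt + MD ^+ 2)).
  rewrite sqrtr_gt0 mulr_gt0 // ltr_wpDl ?exprn_gt0 ?mulr_gt0 //.
  by rewrite mulr_ge0 ?sqr_ge0.
have d4 : 0 < eps * Ma + be * be by rewrite ltr_wpDl ?mulr_gt0 ?mulr_ge0.
have est (b : form R V V) : (forall u v, b u v = b v u) ->
    (forall u, VV u -> alt * `|u| ^+ 2 <= b u u) ->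
    bounded_form Ma b -> nondegenerate b -> nondegenerate (flip b) ->
    projection_bound b (Num.sqrt (Ma / alt)) ->
    projection_bound (flip b) (Num.sqrt (Ma / alt)) ->
    reduced_estimates (constants_A3 Ma MD alt be%:E) b eps.
  move=> bC bc bM n n' p p'.
  have b0 u : VV u -> 0 <= b u u.
    by move=> Vu; rewrite (le_trans _ (bc _ Vu)) // mulr_ge0 ?sqr_ge0 // ltW.
  have hat y : Zt b y -> exists w, [/\ Zh b w, ZZ (y - w),
      `|w| <= 1 * `|y| & alt * `|w| ^+ 2 <= b y y].
    (* By symmetry the component of [y] in [Zhat] is [y] itself, whence [c := 1]. *)
    move=> Ty; exists y; split; [exact: Zhat_sym | | by rewrite mul1r |].
      by rewrite subrr; apply: fin_dim0 fin_dim_discrete_kernel.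
    by apply: bc; case: Ty.
  have pe y q : Zt b y -> QQ q -> (forall v, VV v -> s (D v) q = - b y v) ->
      (be * `|q|) ^+ 2 <= Ma * b y y.
    by move=> [Vy _]; apply: pressure_energy_sym.
  apply: reduced_estimates_of_real (estimates_coercive be_gt0 Ma0 beI MD0 DM
    alt0 bc bM n n' U0 p p' ler01 Ma0 e0 hat pe) => /=.
  - rewrite -EFinM -EFinD inver gt_eqF // -EFinM mulr1.
    (* Here [alt * Ups ^+ 2 = Ma], which turns the general denominator into that of
       [constants_A3]. *)
    by congr (_ / (_ + _))%:E; rewrite U2 -mulrA [alt * _]mulrC divfK // gt_eqF.
  - by rewrite inver gt_eqF // -EFinM.
  - by rewrite -EFinM -EFinD inver gt_eqF // -EFinM.
by rewrite beR; split; apply: est.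
Qed.

End ReducedProblem.

Theorem theorem3p1 (R : realType) (V Q : completeNormedModType R)
    (ipV : {dot V for idfun}) (ipQ : {dot Q for idfun})
    (ipV_norm : induces_norm ipV) (ipQ_norm : induces_norm ipQ)
    (a : {biscalar V}) (D : {linear V -> Q})
    (a_cont : continuous (fun p : V * V => a p.1 p.2))
    (D_bounded : bounded_near D (nbhs (0 : V)))
    (D_surj : range D = [set: Q])
    (Z : set V) (Z_def : Z = D @^-1` [set 0])
    (alpha : R) (alpha_gt0 : 0 < alpha)
    (alpha_left : (alpha%:E <= infsup a Z Z)%E)
    (alpha_right : (alpha%:E <= infsup (fun v u => a u v) Z Z)%E)
    (VV : set V) (QQ : set Q)
    (VV_fin : fin_dim_subspace VV) (QQ_fin : fin_dim_subspace QQ)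
    (D_VV : D @` VV = QQ)
    (ZZ : set V) (ZZ_def : ZZ = discrete_kernel ipQ D VV QQ)
    (alX beX : \bar R) (Ma MD : R)
    (alX_left : alX = infsup a ZZ ZZ)
    (alX_right : alX = infsup (fun v u => a u v) ZZ ZZ)
    (alX_gt0 : (0 < alX)%E)
    (beX_def : beX = infsup (fun q v => ipQ (D v) q) QQ VV)
    (beX_gt0 : (0 < beX)%E)
    (Ma_def : Ma = form_norm a)
    (MD_def : MD = op_norm D) :
  [/\ stable_with ipQ a D VV QQ (constants_general Ma alX beX),
      forall alt : R, structure_A1 ipQ a D VV QQ alt ->
        stable_with ipQ a D VV QQ (constants_A1 Ma alt beX),
      forall alt : R, structure_A2 a VV alt ->
        stable_with ipQ a D VV QQ (constants_A2 Ma MD alt beX) &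
      forall alt : R, structure_A3 a VV alt ->
        stable_with ipQ a D VV QQ (constants_A3 Ma MD alt beX)].
Proof.
have mC := dot_formC ipV; have mN := dot_form_norm ipV_norm.
have sC := dot_formC ipQ; have sN := dot_form_norm ipQ_norm.
have DM := op_normP D_bounded; rewrite -MD_def in DM.
have MD0 : 0 <= MD by rewrite MD_def op_norm_ge0.
have aM := form_normP a_cont; rewrite -Ma_def in aM.
have Ma0 : 0 <= Ma by rewrite Ma_def form_norm_ge0.
rewrite ZZ_def in alX_left alX_right.
split=> [|alt A|alt A|alt A].
- exact: (stable_general mC mN sC sN VV_fin QQ_fin D_VV DM Ma0 aM
    alX_left alX_right alX_gt0 beX_def beX_gt0).
- exact: (stable_semicoercive mC mN sC sN VV_fin QQ_fin D_VV DM Ma0 aM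
    beX_def beX_gt0 A).
- exact: (stable_coercive_nonsym mC mN sC sN VV_fin QQ_fin D_VV MD0 DM Ma0 aM
    beX_def beX_gt0 A).
- exact: (stable_coercive_sym mC mN sC sN VV_fin QQ_fin D_VV MD0 DM Ma0 aM
    beX_def beX_gt0 A).
Qed.
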